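(* Let $$\Omega_{\mathbb N}=\{F:\mathbb N\to\mathbb N\ :\ \mathcal K_F\text{ is bounded on }l^2(\mathbb N)\},\qquad \Lambda_{\mathbb N}=\{F\mapsto F(j):j\in\mathbb N\},$$ where $[\mathcal K_Fx](j)=x(F(j))$ for $x:\mathbb N\to\mathbb C$, and let $\Xi_{\mathrm{Sp}_{\mathrm{ap}}}(F)=\mathrm{Sp}_{\mathrm{ap}}(\mathcal K_F)$. Then $$\Delta_3^G\not\owns\{\Xi_{\mathrm{Sp}_{\mathrm{ap}}},\Omega_{\mathbb N},\mathcal M_{\mathrm H},\Lambda_{\mathbb N}\}\in\Pi_3^A.$$ That is, the approximate point spectrum cannot be computed in two limits by any tower of general algorithms, but there is an arithmetic $\Pi_3$-tower.
   Context: $\mathbb N=\{1,2,\dots\}$. $\mathrm{Sp}_{\mathrm{ap}}(T)=\{\lambda\in\mathbb C:\exists \|u_n\|=1,\ \lim_n\|(T-\lambda I)u_n\|=0\}$. $\mathcal M_{\mathrm H}$ is the set of non-empty compact subsets of $\mathbb C$ with the Hausdorff metric $d_{\mathrm H}$. **Computational problems.** A computational problem $\{\Xi,\Omega,\mathcal M,\Lambda\}$ consists of a set $\Omega$, a metric space $(\mathcal M,d)$, a function $\Xi:\Omega\to\mathcal M$, and a set $\Lambda$ of functions on $\Omega$ such that $\Xi(A)\ne\Xi(B)$ implies $f(A)\neq f(B)$ for some $f\in\Lambda$. **General algorithms and towers.** A general algorithm is a map $\Gamma:\Omega\to\mathcal M$ such that for every $A\in\Omega$ there is a non-empty finite $\Lambda_\Gamma(A)\subset\Lambda$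 such that if $B\in\Omega$ and $f(A)=f(B)$ for all $f\in\Lambda_\Gamma(A)$, then $\Lambda_\Gamma(B)=\Lambda_\Gamma(A)$ and $\Gamma(B)=\Gamma(A)$. A general tower of algorithms of height $k\in\mathbb N$ is a family $\Gamma_{n_k},\Gamma_{n_k,n_{k-1}},\dots,\Gamma_{n_k,\dots,n_1}:\Omega\to\mathcal M$ ($n_i\in\mathbb N$), where the $\Gamma_{n_k,\dots,n_1}$ are general algorithms and, for every $A\in\Omega$, $\Xi(A)=\lim_{n_k\to\infty}\Gamma_{n_k}(A)$, $\Gamma_{n_k}(A)=\lim_{n_{k-1}\to\infty}\Gamma_{n_k,n_{k-1}}(A)$, ..., $\Gamma_{n_k,\dots,n_2}(A)=\lim_{n_1\to\infty}\Gamma_{n_k,\dots,n_1}(A)$. A tower is arithmetic (type $A$; here $\Lambda$ is countable) if each output $\Gamma_{n_k,\dots,n_1}(A)$ is a finite string of numbers (or encoding) that can be identified with an element of $\mathcal M$ and the function $(n_k,\dots,n_1,\{f(A)\}_{f\in\Lambda})\mapsto\Gamma_{n_k,\dots,n_1}(A)$ is recursive (with the evaluations $\{f(A)\}_{f\in\Lambda}$ accessed as an oracle). **Classes.** A problem is in $\Delta_3^G$ if it is solved by a general tower of height at most $2$. A problem with $\mathcal M=\mathcal M_{\mathrm H}$ is in $\Pi_3^A$ if there are an arithmetic tower $\{\Gamma_{n_3,n_2,n_1}\}$ of height $3$ and sets $X_{n_3}(A)\in\mathcal M_{\mathrm H}$ such that for all $A\in\Omega$: $\Xi(A)\subset X_{n_3}(A)$,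 $\lim_{n_3\to\infty}\Gamma_{n_3}(A)=\Xi(A)$, and $d_{\mathrm H}(X_{n_3}(A),\Gamma_{n_3}(A))\le2^{-n_3}$. *)

(* Defs.v *)
From HB Require Import structures.
From mathcomp Require Import all_boot all_order all_algebra.
From mathcomp Require Import all_classical all_reals all_analysis.
From mathcomp Require Import complex.

Set Implicit Arguments.
Unset Strict Implicit.
Unset Printing Implicit Defensive.

Import Order.TTheory GRing.Theory Num.Theory.
Import numFieldNormedType.Exports.

Local Open Scope classical_set_scope.
Local Open Scope ring_scope.

(* Throughout, the index set {1, 2, 3, ...} is represented by nat through    *)
(* n |-> n - 1, both for the coordinates of a sequence and for the indices   *)
(* of a tower of algorithms; hence the bound 2 ^- n.+1 in Pi3A.              *)

Section ComplexPlane.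
Variable R : realType.

(* Rcomplex R is the field R[i] with its modulus as an R-valued norm; the    *)
(* library does not equip it with the induced topology.                      *)
HB.instance Definition _ :=
  PseudoMetric.copy (Rcomplex R) (pseudoMetric_normed (Rcomplex R)).
HB.instance Definition _ := isPointed.Build (Rcomplex R) 0.
HB.instance Definition _ :=
  NormedZmod_PseudoMetric_eq.Build R (Rcomplex R) erefl.

Let Rcomplex_normrZ (l : R) (x : Rcomplex R) : `|l *: x| = `|l| * `|x|.
Proof.
have -> : l *: x = (l%:C)%C * x :> Rcomplex R.
  by case: x => a b; congr Complex; rewrite !mul0r ?subr0 ?addr0.
rewrite [LHS](@ComplexField.Normc.normcM R (l%:C)%C x); congr (_ * _).
by rewrite /ComplexField.Normc.normc/= expr0n/= addr0 sqrtr_sqr.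
Qed.

HB.instance Definition _ :=
  PseudoMetricNormedZmod_Lmodule_isNormedModule.Build R (Rcomplex R)
    Rcomplex_normrZ.

End ComplexPlane.

Section Hausdorff.
Variable R : realType.
Local Notation C := (Rcomplex R).

Record compacts := Compacts {
  cset :> set C;
  cset_compact : compact cset;
  cset_nonempty : cset !=set0 }.

HB.instance Definition _ := gen_eqMixin compacts.
HB.instance Definition _ := gen_choiceMixin compacts.

Definition dist_to (x : C) (A : set C) : R := inf [set `|x - a| | a in A].

Definition excess (A B : set C) : R := sup [set dist_to x B | x in A].

Definition hausdorff_dist (A B : compacts) : R :=
  Num.max (excess A B) (excess B A).

Implicit Types A B : compacts.

Lemma compacts_inj A B : cset A = cset B -> A = B.
Proof.
case: A B => [A cA A0] [B cB B0] /= AB; case: _ / AB in cB B0 *.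
by congr Compacts; exact: Prop_irrelevance.
Qed.

Lemma has_lbound_dist x (A : set C) : has_lbound [set `|x - a| | a in A].
Proof. by exists 0 => _ [a _ <-]. Qed.

Lemma dist_to_le x (A : set C) a : A a -> dist_to x A <= `|x - a|.
Proof. by move=> Aa; apply: ge_inf; [exact: has_lbound_dist | exists a]. Qed.

Lemma dist_to_ge0 x A : 0 <= dist_to x A.
Proof.
have [a Aa] := cset_nonempty A.
by apply: lb_le_inf => [|_ [b _ <-]//]; exists `|x - a|, a.
Qed.

Lemma dist_to_lt x A e : 0 < e -> exists2 a, cset A a & `|x - a| < dist_to x A + e.
Proof.
move=> e0; have [a Aa] := cset_nonempty A.
have /(inf_adherent e0)[_ [b Ab <-] ?] : has_inf [set `|x - a| | a in A].
  by split; [exists `|x - a|, a | exact: has_lbound_dist].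
by exists b.
Qed.

Lemma dist_to_lip x y A : dist_to x A <= `|x - y| + dist_to y A.
Proof.
apply/ler_addgt0Pr => e e0; have [a Aa ya] := dist_to_lt y A e0.
rewrite (le_trans (dist_to_le x Aa))// -addrA.
have -> : x - a = (x - y) + (y - a) by rewrite addrA subrK.
by rewrite (le_trans (ler_normD _ _))// lerD2l ltW.
Qed.

Lemma dist_to_excess A B x : cset A x -> dist_to x B <= excess A B.
Proof.
move=> Ax; apply: ub_le_sup; last by exists x.
have [b Bb] := cset_nonempty B.
have [M [_ AM]] := compact_bounded (@cset_compact A).
exists (M + 1 + `|b|) => _ [y Ay <-].
rewrite (le_trans (dist_to_le y Bb))// (le_trans (ler_normB _ _))// lerD2r.
by apply: AM => //; rewrite ltrDl.
Qed.

Lemma excess_ge0 A B : 0 <= excess A B.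
Proof.
have [a Aa] := cset_nonempty A.
exact: le_trans (dist_to_ge0 a B) (dist_to_excess B Aa).
Qed.

Lemma excess_le A B r : (forall x, cset A x -> dist_to x B <= r) ->
  excess A B <= r.
Proof.
move=> Ar; have [a Aa] := cset_nonempty A.
by apply: ge_sup => [|_ [x Ax <-]]; [exists (dist_to a B), a | exact: Ar].
Qed.

Lemma excess_triangle B A (D : compacts) :
  excess A D <= excess A B + excess B D.
Proof.
apply: excess_le => x Ax; apply/ler_addgt0Pr => e e0.
have [b Bb xb] := dist_to_lt x B e0.
rewrite (le_trans (dist_to_lip x b D))// addrAC lerD ?dist_to_excess//.
by rewrite (le_trans (ltW xb))// lerD2r dist_to_excess.
Qed.

Lemma excess_xx A : excess A A = 0.
Proof.
apply/eqP; rewrite eq_le excess_ge0 andbT; apply: excess_le => x Ax.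
by rewrite (le_trans (dist_to_le x Ax))// subrr normr0.
Qed.

Lemma excess_sub A B : excess A B <= 0 -> cset A `<=` cset B.
Proof.
move=> AB x Ax.
have cB : closed (cset B).
  by apply: compact_closed (@cset_compact B); exact: norm_hausdorff.
apply: cB => U /nbhs_ballP[e /= e0 xU].
have [b Bb xb] := dist_to_lt x B e0.
exists b; split => //; apply: xU; rewrite -ball_normE/=.
rewrite (lt_le_trans xb)// gerDr.
exact: le_trans (dist_to_excess B Ax) AB.
Qed.

Let hausdorff_dist_xx A : hausdorff_dist A A = 0.
Proof. by rewrite /hausdorff_dist excess_xx maxxx. Qed.

Let hausdorff_dist_eq0 A B : hausdorff_dist A B = 0 -> A = B.
Proof.
move=> /eqP; rewrite eq_le => /andP[+ _]; rewrite ge_max => /andP[AB BA].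
by apply/compacts_inj/seteqP; split; exact: excess_sub.
Qed.

Let hausdorff_dist_sym A B : hausdorff_dist A B = hausdorff_dist B A.
Proof. exact: maxC. Qed.

Let hausdorff_dist_triangle B A (D : compacts) :
  hausdorff_dist A D <= hausdorff_dist A B + hausdorff_dist B D.
Proof.
rewrite [leLHS]/hausdorff_dist ge_max; apply/andP; split.
  by rewrite (le_trans (excess_triangle B A D))// lerD// le_max lexx.
rewrite (le_trans (excess_triangle B D A))// addrC lerD// le_max lexx orbT//.
Qed.

HB.instance Definition _ := isMetric.Build R compacts hausdorff_dist_xx
  hausdorff_dist_eq0 hausdorff_dist_sym hausdorff_dist_triangle.

End Hausdorff.

Section Towers.
Variables (R : realType) (Om V : Type) (M : metricType R).

Record comp_problem := CompProblem {
  Xi : Om -> M;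
  Lam : set (Om -> V);
  Lam_separates : forall A B, Xi A <> Xi B -> exists2 f, Lam f & f A <> f B }.

Definition general_algorithm (P : comp_problem) (Gam : Om -> M) : Prop :=
  exists L : Om -> set (Om -> V), forall A : Om,
    [/\ L A `<=` Lam P, L A !=set0, finite_set (L A) &
        forall B : Om, (forall f, L A f -> f A = f B) ->
          L B = L A /\ Gam B = Gam A].

(* G [:: n_k; ...; n_j] is Gamma_{n_k, ..., n_j}, and G [::] is Xi; values   *)
(* of G at longer sequences than k are irrelevant.                           *)
Definition general_tower (P : comp_problem) (k : nat)
    (G : seq nat -> Om -> M) : Prop :=
  [/\ G [::] = Xi P,
      forall s (A : Om), (size s < k)%N ->
        G (rcons s n) A @[n --> \oo] --> G s A &
      forall s, size s = k -> general_algorithm P (G s)].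

Definition Delta3G (P : comp_problem) : Prop :=
  exists2 k, (1 <= k <= 2)%N & exists G, general_tower P k G.

End Towers.

(* Partial recursive functions relative to an oracle on nat. Programs are    *)
(* untyped: missing arguments count as 0, superfluous ones are ignored.      *)
Inductive oprog : Type :=
  | OZero
  | OSucc
  | OProj of nat
  | OOracle
  | OComp of oprog & seq oprog
  | ORec of oprog & oprog
  | OMin of oprog.

(* oeval o p xs y: with oracle o and on input xs, p halts with output y.     *)
Fixpoint oeval (o : nat -> nat) (p : oprog) (xs : seq nat) (y : nat) : Prop :=
  match p with
  | OZero => y = 0%N
  | OSucc => y = (nth 0 xs 0).+1%N
  | OProj i => y = nth 0%N xs i
  | OOracle => y = o (nth 0 xs 0)%N
  | OComp f gs => exists2 ys : seq nat,
      (fix oevals (gs : seq oprog) (ys : seq nat) : Prop :=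
         match gs, ys with
         | [::], [::] => True
         | g :: gs', y' :: ys' => oeval o g xs y' /\ oevals gs' ys'
         | _, _ => False
         end) gs ys
      & oeval o f ys y
  | ORec f g => exists r : nat -> nat,
      [/\ oeval o f (behead xs) (r 0%N),
          forall i, (i < nth 0 xs 0)%N ->
            oeval o g [:: i, r i & behead xs] (r i.+1)
        & y = r (nth 0 xs 0)%N]
  | OMin f => oeval o f (y :: xs) 0%N /\
      forall i, (i < y)%N -> exists v, oeval o f (i :: xs) v.+1
  end.

Section ArithmeticTowers.
Variable R : realType.
Local Notation C := (Rcomplex R).

(* Each block a, b, c, d, m of five numbers stands for the complex rational  *)
(* ((a - b) + (c - d) i) / (m + 1).                                          *)
Fixpoint points (s : seq nat) : seq C :=
  match s with
  | [:: a, b, c, d, m & s'] =>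
      Complex ((a%:R - b%:R) / m.+1%:R) ((c%:R - d%:R) / m.+1%:R) :: points s'
  | _ => [::]
  end.

(* The output string is passed through the bijection CodeSeq.decode from nat *)
(* to seq nat. The enumeration e of Lam P is a parameter, as the evaluations *)
(* are queried through it: the oracle for A is the sequence j |-> e j A.     *)
Definition arithmetic_tower (Om : Type)
    (P : comp_problem Om nat (compacts R)) (e : nat -> Om -> nat) (k : nat)
    (G : seq nat -> Om -> compacts R) : Prop :=
  [/\ Lam P = range e, general_tower P k G &
      exists p : oprog, forall (A : Om) s, size s = k ->
        exists2 c : nat, oeval (fun j => e j A) p s c &
          G s A = [set` points (CodeSeq.decode c)] :> set C].

Definition Pi3A (Om : Type) (P : comp_problem Om nat (compacts R))
    (e : nat -> Om -> nat) : Prop :=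
  exists (G : seq nat -> Om -> compacts R) (X : nat -> Om -> compacts R),
    arithmetic_tower P e 3 G /\
    forall A : Om,
      [/\ forall n, Xi P A `<=` X n A,
          G [:: n] A @[n --> \oo] --> Xi P A &
          forall n, mdist (X n A) (G [:: n] A) <= 2 ^- n.+1].

End ArithmeticTowers.

Section Koopman.
Variable R : realType.
Local Notation C := (Rcomplex R).

Definition sqnorm (x : nat -> C) : \bar R :=
  (\sum_(0 <= j <oo) (`|x j| ^+ 2)%:E)%E.

Definition l2 : set (nat -> C) := [set x | (sqnorm x < +oo)%E].

Definition l2norm (x : nat -> C) : R := Num.sqrt (fine (sqnorm x)).

Definition bounded_on_l2 (T : (nat -> C) -> (nat -> C)) : Prop :=
  exists c : R, forall x, l2 x -> l2 (T x) /\ l2norm (T x) <= c * l2norm x.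

(* Meaningful for operators T mapping l2 to l2 only. *)
Definition Sp_ap (T : (nat -> C) -> (nat -> C)) : set C :=
  [set lam | exists u : nat -> nat -> C,
     (forall n, l2 (u n) /\ l2norm (u n) = 1) /\
     l2norm (fun j => T (u n) j - lam * u n j) @[n --> \oo] --> (0 : R)].

Definition koopman (F : nat -> nat) (x : nat -> C) : nat -> C :=
  fun j => x (F j).

Definition OmegaN : Type := {F : nat -> nat | bounded_on_l2 (koopman F)}.

Definition evalN (j : nat) (F : OmegaN) : nat := sval F j.

Lemma evalN_separates (M : Type) (Xi : OmegaN -> M) (F H : OmegaN) :
  Xi F <> Xi H -> exists2 f, range evalN f & f F <> f H.
Proof.
move=> FH; apply: contrapT => sep; apply: FH; congr Xi.
apply: eq_sig_hprop => [? ? ?|]; first exact: Prop_irrelevance.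
apply/funext => j; apply: contrapT => FHj.
by apply: sep; exists (evalN j) => //; exists j.
Qed.

Definition problemN (Xi : OmegaN -> compacts R) :
    comp_problem OmegaN nat (compacts R) :=
  CompProblem (@evalN_separates _ Xi).

End Koopman.

(* Main.v *)
Require Import Defs.
From mathcomp Require Import all_boot all_order all_algebra.
From mathcomp Require Import all_classical all_reals all_analysis.
From mathcomp Require Import complex.
From mathcomp Require Import ring lra zify.

(** Write T for the operator x |-> x o F and S(x) for the squared l2 norm.
    A point lam is in the approximate point spectrum iff for every e > 0 some
    nonzero v in l2 satisfies S(Tv - lam v) <= e S(v) (Sp_apP), and v may be
    taken finitely supported with Gaussian integer entries
    (Sp_ap_gaussian_vec). So membership has the form: for all e there is an
    integer vector v such that all partial sums of S(Tv - lam v) are small.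
    Those three quantifiers are the three limits of the upper bound, and the
    lower bound says that two limits do not suffice.

    The spectrum is compact by routine estimates. That it is not empty
    (Sp_ap_nonempty) has an elementary proof here. If F misses a point, 0 is an
    eigenvalue; if all points are periodic, the indicator of a cycle is an
    eigenvector for 1. Otherwise F is onto and some j is not periodic, so the
    fibres of the iterates of F over j are disjoint nonempty sets. Let a_k be
    the size of the k-th one. The weighted sums of their indicators over a
    window s <= k < n are test vectors for any real lam > 0, and their residual
    lives on the two ends of the window. If no positive lam were in the spectrum,
    the terms a_k lam^(-2k) of every window would be controlled by the two end
    terms, for all lam at once; this lets one lower the exponential rate that
    bounds a_k again and again until a_k < 1, which is absurd
    (no_two_sided_growth).

    Lower bound. The set of sequences x of naturals that tend to infinity is
    not a countable union of countable intersections of open sets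
    (tends_to_infty_not_Gdelta_sigma), whereas a tower of height two would
    present it in this way once x is encoded, continuously, in a map F for which
    1 is in the spectrum when x tends to infinity and the spectrum stays at a
    fixed distance from 1 otherwise. The map [graph x] does this. It consists of
    trees in which every vertex has at least two preimages, where T expands
    norms by at least sqrt 2, and of chains of links. A chain of length k + 1
    that starts at time s stays isolated as long as x n > k for n >= s, and its
    indicator is then an approximate eigenvector for 1. If x n <= k happens,
    every link of the chain gets two preimages inside the trees, and the chain is
    absorbed by the expanding part. Hence arbitrarily long isolated chains
    exist iff x tends to infinity (graph_Sp_ap1, graph_gap).

    Upper bound. With mesh M = 2^(m+2), the third-limit set [accepted] collects
    the points z of the grid (Z + iZ)/M for which some integer vector v has
    S(Tv - zv) < (16/M^2) S(v), up to equality in the limit. The first limit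
    decides, for each of the finitely many candidates below W, whether all
    partial sums stay below the bound; the second lets W grow. Both limits
    are eventually constant. The third converges by compactness, and every
    point of the spectrum is within sqrt 2 / M of [accepted] because rounding
    lam to the grid costs 2/M^2 in squared distance. The corresponding finite
    sets are computed by bounded sums and loops on natural numbers, for which
    [computable] has the usual closure properties. *)

Set Implicit Arguments.
Unset Strict Implicit.
Unset Printing Implicit Defensive.

Import Order.TTheory GRing.Theory Num.Theory.
Import numFieldNormedType.Exports.

Local Open Scope classical_set_scope.
Local Open Scope ring_scope.

(** * Sums of squares of complex sequences *)

Section SquareSums.
Variable R : realType.
Local Notation C := (Rcomplex R).
Implicit Types (x y z : nat -> C) (A : set nat).

Lemma normCM (a b : C) : `|a * b : C| = `|a| * `|b|.
Proof. exact: (@ComplexField.Normc.normcM R a b). Qed.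

Lemma sqr_normC (a b : R) : `|Complex a b : C| ^+ 2 = a ^+ 2 + b ^+ 2.
Proof. by rewrite [X in X ^+ 2]/(Num.sqrt _) sqr_sqrtr// addr_ge0// sqr_ge0. Qed.

Lemma normC_real (a : R) : `|Complex a 0 : C| = `|a|.
Proof.
apply/eqP; rewrite -(@eqrXn2 _ 2)// ?normr_ge0//.
by rewrite sqr_normC expr0n addr0 real_normK// num_real.
Qed.

Lemma normC1 : `|1 : C| = 1.
Proof. exact: etrans (normC_real 1) (normr1 _). Qed.

Lemma sqr_normC_addw (t : R) (a b : C) : 0 < t ->
  `|a + b : C| ^+ 2 <= (1 + t) * `|a| ^+ 2 + (1 + t^-1) * `|b| ^+ 2.
Proof.
move=> t0; apply: (@le_trans _ _ ((`|a| + `|b|) ^+ 2)).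
  by rewrite ler_sqr ?nnegrE ?addr_ge0 ?normr_ge0// ler_normD.
rewrite -subr_ge0.
have -> : (1 + t) * `|a| ^+ 2 + (1 + t^-1) * `|b| ^+ 2 - (`|a| + `|b|) ^+ 2
  = t * (`|a| - t^-1 * `|b|) ^+ 2 by field; rewrite gt_eqF.
by rewrite mulr_ge0 ?sqr_ge0// ltW.
Qed.

Lemma sqr_normC_add (a b : C) :
  `|a + b : C| ^+ 2 <= 2 * `|a| ^+ 2 + 2 * `|b| ^+ 2.
Proof. by have := sqr_normC_addw a b ltr01; rewrite invr1. Qed.

Lemma sqnorm_esum x : sqnorm x = \esum_(j in setT) (`|x j| ^+ 2)%:E.
Proof. by rewrite /sqnorm nneseries_esumT// => n; rewrite lee_fin sqr_ge0. Qed.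

Lemma sqnorm_ge0 x : (0 <= sqnorm x)%E.
Proof. by apply: nneseries_ge0 => n _ _; rewrite lee_fin sqr_ge0. Qed.

Lemma partial_le_sqnorm x n :
  ((\sum_(j < n) `|x j| ^+ 2)%:E <= sqnorm x)%E.
Proof.
rewrite -(big_mkord xpredT (fun j => `|x j| ^+ 2)) -sumEFin.
by apply: nneseries_lim_ge => i _ _; rewrite lee_fin sqr_ge0.
Qed.

(** Bounds on the infinite sum amount to bounds on finite sums of reals, which
    is what an algorithm can test. *)
Lemma sqnorm_leP x (M : R) :
  (sqnorm x <= M%:E)%E <-> forall n, \sum_(j < n) `|x j| ^+ 2 <= M.
Proof.
split=> [xM n|xM].
  by rewrite -lee_fin (le_trans (partial_le_sqnorm x n)).
apply: lime_le; first by apply: is_cvg_nneseries => n _ _; rewrite lee_fin sqr_ge0.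
by apply: nearW => n; rewrite sumEFin lee_fin big_mkord.
Qed.

Lemma sqnorm_lin x y z (a b : R) : 0 <= a -> 0 <= b ->
  (forall j, `|x j| ^+ 2 <= a * `|y j| ^+ 2 + b * `|z j| ^+ 2) ->
  (sqnorm x <= a%:E * sqnorm y + b%:E * sqnorm z)%E.
Proof.
move=> a0 b0 xyz.
rewrite /sqnorm -!nneseriesZl//; try by move=> i _; rewrite lee_fin sqr_ge0.
rewrite -nneseriesD; try by move=> i _ _; rewrite mule_ge0// lee_fin ?sqr_ge0.
apply: lee_nneseries => j _; first by rewrite lee_fin sqr_ge0.
by rewrite -!EFinM -EFinD lee_fin xyz.
Qed.

Lemma sqnormD x y :
  (sqnorm (fun j => (x j + y j)%R) <= 2%:E * sqnorm x + 2%:E * sqnorm y)%E.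
Proof. by apply: sqnorm_lin => // j; exact: sqr_normC_add. Qed.

Lemma le_sqnorm x y (a : R) : 0 <= a ->
  (forall j, `|x j| ^+ 2 <= a * `|y j| ^+ 2) ->
  (sqnorm x <= a%:E * sqnorm y)%E.
Proof.
move=> a0 xy; rewrite -[leRHS]adde0 -(mul0e (sqnorm y)).
by apply: sqnorm_lin => // j; rewrite mul0r addr0.
Qed.

Lemma sqnormZ (a : C) x :
  sqnorm (fun j => a * x j) = ((`|a| ^+ 2)%:E * sqnorm x)%E.
Proof.
rewrite /sqnorm -nneseriesZl; last by move=> i _; rewrite lee_fin sqr_ge0.
by apply: eq_eseriesr => j _; rewrite normCM exprMn EFinM.
Qed.

Definition cutoff (A : set nat) (x : nat -> C) : nat -> C :=
  fun j => if j \in A then x j else 0.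

Lemma cutoff_in A x j : A j -> cutoff A x j = x j.
Proof. by move=> Aj; rewrite /cutoff mem_set. Qed.

Lemma cutoff_out A x j : ~ A j -> cutoff A x j = 0.
Proof. by move=> Aj; rewrite /cutoff memNset. Qed.

Lemma sqnorm_cutoff A x : (sqnorm (cutoff A x) <= sqnorm x)%E.
Proof.
rewrite -[leRHS]mul1e; apply: le_sqnorm => // j; rewrite mul1r /cutoff.
by case: ifP; rewrite ?normr0 ?expr0n ?sqr_ge0.
Qed.

Lemma sqnorm_cutoff_esum A x :
  sqnorm (cutoff A x) = \esum_(j in A) (`|x j| ^+ 2)%:E.
Proof.
rewrite sqnorm_esum esum_mkcond [RHS]esum_mkcond; apply: eq_esum => j _.
by rewrite in_setT /cutoff; case: ifP => //; rewrite normr0 expr0n.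
Qed.

Lemma cutoff_setT x : cutoff setT x = x.
Proof. by apply/funext => j; rewrite cutoff_in. Qed.

Lemma sqnormID A B x : sqnorm (cutoff A x) =
  (sqnorm (cutoff (A `&` B) x) + sqnorm (cutoff (A `&` ~` B) x))%E.
Proof.
by rewrite !sqnorm_cutoff_esum (esumID B)// => i _; rewrite lee_fin sqr_ge0.
Qed.

Lemma sqnorm_cutoff_sub A B x : A `<=` B ->
  (sqnorm (cutoff A x) <= sqnorm (cutoff B x))%E.
Proof.
move=> AB; rewrite -[leRHS]mul1e; apply: le_sqnorm => // j; rewrite mul1r.
have [Aj|nAj] := pselect (A j); first by rewrite !cutoff_in//; exact: AB.
by rewrite cutoff_out// normr0 expr0n sqr_ge0.
Qed.

(** Reindexing along h turns the left side into a sum over the image of A,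
    which is part of B. *)
Lemma sqnorm_inj A B (h : nat -> nat) x :
  {in A &, injective h} -> (forall i, A i -> B (h i)) ->
  (sqnorm (cutoff A (x \o h)) <= sqnorm (cutoff B x))%E.
Proof.
move=> hA AB.
rewrite !sqnorm_cutoff_esum -(@esum_image _ _ _ A h (fun j => (`|x j| ^+ 2)%:E))//.
rewrite -!sqnorm_cutoff_esum; apply: sqnorm_cutoff_sub => _ [i Ai <-]; exact: AB.
Qed.

(** On each of the d classes F is injective, so each of them contributes at
    most the squared norm of x. *)
Lemma sqnorm_classes (d : nat) (cls F : nat -> nat) x :
  (forall j, (cls j < d)%N) ->
  (forall i j, cls i = cls j -> F i = F j -> i = j) ->
  (sqnorm (x \o F) <= (d%:R)%:E * sqnorm x)%E.
Proof.
move=> clsd clsF; rewrite sqnorm_esum.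
rewrite (eq_esum (b := fun j => \sum_(e < d)
   (if (cls j == e :> nat) then (`|x (F j)| ^+ 2)%:E else 0))%E); last first.
  move=> j _; rewrite (bigD1 (Ordinal (clsd j)))//= eqxx big1 ?adde0// => e.
  by move=> ne; rewrite ifF//; apply: contraNF ne => /eqP ej; apply/eqP/val_inj.
rewrite esum_sum; last by move=> i j _ _; case: ifP => // _; rewrite lee_fin sqr_ge0.
apply: (@le_trans _ _ (\sum_(e < d) sqnorm x)%E); last first.
  elim: {clsd}d => [|d IH]; first by rewrite big_ord0 mul0e.
  by rewrite big_ord_recr/= -natr1 EFinD ge0_muleDl ?lee_fin// mul1e leeD2r.
apply: lee_sum => e _.
rewrite -[leRHS](congr1 (@sqnorm R) (cutoff_setT x)).
apply: le_trans (@sqnorm_inj [set j | cls j = e] setT F x _ _) => //.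
  rewrite sqnorm_cutoff_esum [leRHS]esum_mkcond; apply: le_esum => j _.
  case: ifP => [/eqP je|_]; first by rewrite mem_set.
  by case: ifP => // _; rewrite lee_fin sqr_ge0.
by move=> i j /set_mem/= ie /set_mem/= je; apply: clsF; rewrite ie je.
Qed.

Lemma l2E x : l2 x -> sqnorm x = (fine (sqnorm x))%:E.
Proof. by move=> xl; rewrite fineK// ge0_fin_numE// sqnorm_ge0. Qed.

Lemma l2norm_sqr x : l2norm x ^+ 2 = fine (sqnorm x).
Proof. by rewrite sqr_sqrtr// fine_ge0// sqnorm_ge0. Qed.

Lemma l2_le x y (a : R) : (sqnorm x <= a%:E * sqnorm y)%E -> l2 y -> l2 x.
Proof.
by move=> xy yl; rewrite /l2/= (le_lt_trans xy)// (l2E yl) -EFinM ltry.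
Qed.

Lemma l2D x y : l2 x -> l2 y -> l2 (fun j => x j + y j).
Proof.
move=> xl yl; rewrite /l2/= (le_lt_trans (sqnormD x y))//.
by rewrite (l2E xl) (l2E yl) -!EFinM -EFinD ltry.
Qed.

Lemma l2Z (a : C) x : l2 x -> l2 (fun j => a * x j).
Proof. by apply: (@l2_le _ _ (`|a| ^+ 2)); rewrite sqnormZ. Qed.

Lemma l2_cutoff A x : l2 x -> l2 (cutoff A x).
Proof. by apply: le_lt_trans; exact: sqnorm_cutoff. Qed.

Lemma sqnorm_ge_at x j : ((`|x j| ^+ 2)%:E <= sqnorm x)%E.
Proof.
apply: le_trans (partial_le_sqnorm x j.+1); rewrite lee_fin big_ord_recr/=.
by rewrite lerDr sumr_ge0// => i _; rewrite sqr_ge0.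
Qed.

Lemma sqnorm_finsupp x n : (forall j, (n <= j)%N -> x j = 0) ->
  sqnorm x = (\sum_(j < n) `|x j| ^+ 2)%:E.
Proof.
move=> xn; apply/eqP; rewrite eq_le partial_le_sqnorm andbT.
apply/sqnorm_leP => m; have [mn|/ltnW nm] := leqP m n.
  rewrite -(subnKC mn) big_split_ord/= lerDl sumr_ge0//.
rewrite -(subnKC nm) big_split_ord/= [X in _ + X]big1 ?addr0//.
by move=> i _; rewrite xn ?leq_addr// normr0 expr0n.
Qed.

Lemma sqnorm_tail x (e : R) : l2 x -> 0 < e ->
  exists n, (sqnorm (cutoff [set j | (n <= j)%N] x) <= e%:E)%E.
Proof.
move=> xl e0.
have [n xn] : exists n, fine (sqnorm x) - e < \sum_(j < n) `|x j| ^+ 2.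
  apply: contrapT => /forallNP H.
  have : (sqnorm x <= (fine (sqnorm x) - e)%:E)%E.
    by apply/sqnorm_leP => n; rewrite leNgt; apply/negP/H.
  by rewrite {1}(l2E xl) lee_fin lerBrDr gerDl leNgt e0.
exists n.
have := @sqnormID setT [set j | (n <= j)%N] x; rewrite !setTI cutoff_setT.
have -> : sqnorm (cutoff (~` [set j | (n <= j)%N]) x) =
    (\sum_(j < n) `|x j| ^+ 2)%:E.
  rewrite (@sqnorm_finsupp _ n) => [|j nj]; last by rewrite cutoff_out//; apply.
  by congr EFin; apply: eq_bigr => j _; rewrite cutoff_in//= => /(leq_trans (ltn_ord j)); rewrite ltnn.
have tl : l2 (cutoff [set j | (n <= j)%N] x) by exact: l2_cutoff.
rewrite (l2E tl) (l2E xl) -EFinD => -[E]; rewrite lee_fin.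
by move: xn; rewrite E; lra.
Qed.

End SquareSums.

(** * Approximate eigenvectors *)

Section Spectrum.
Variable R : realType.
Local Notation C := (Rcomplex R).
Implicit Types (F : nat -> nat) (x u v : nat -> C) (lam mu : C) (c e d : R).

Definition resid F lam x : nat -> C := fun j => x (F j) - lam * x j.

(** Boundedness in terms of squared norms, so that no square roots appear; c
    stands for the square of the operator norm. *)
Definition koopman_bound F c :=
  forall x, l2 x -> (sqnorm (x \o F) <= c%:E * sqnorm x)%E.

Lemma koopman_boundP F : bounded_on_l2 (koopman (R := R) F) <->
  exists2 c, 0 < c & koopman_bound F c.
Proof.
split=> [[c cP]|[c c0 cP]]; last first.
  exists (Num.sqrt c) => x xl; split; first exact: l2_le (cP x xl) xl.
  rewrite -ler_sqr ?nnegrE ?mulr_ge0 ?sqrtr_ge0//.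
  rewrite exprMn !l2norm_sqr (sqr_sqrtr (ltW c0)) -lee_fin EFinM -(l2E xl).
  by rewrite -l2E ?cP//; exact: l2_le (cP x xl) xl.
exists (c ^+ 2 + 1); first by rewrite ltr_wpDl// sqr_ge0.
move=> x xl; have [xFl xFc] := cP x xl.
rewrite [leLHS](l2E xFl) (l2E xl) -EFinM lee_fin -!l2norm_sqr.
apply: (@le_trans _ _ ((c * l2norm x) ^+ 2)).
  rewrite ler_sqr ?nnegrE ?sqrtr_ge0//.
  by rewrite (le_trans _ xFc)// sqrtr_ge0.
by rewrite exprMn ler_wpM2r ?sqr_ge0// lerDl.
Qed.

(** An approximate eigenvalue, e being the squared relative error. *)
Definition approx_eig F lam e := exists v : nat -> C,
  [/\ l2 v, (0 < sqnorm v)%E & (sqnorm (resid F lam v) <= e%:E * sqnorm v)%E].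

Lemma residZ F lam (a : C) v :
  resid F lam (fun j => a * v j) = (fun j => a * resid F lam v j).
Proof. by apply/funext => j; rewrite /resid mulrBr mulrCA. Qed.

Lemma approx_eig_le F lam d e : d <= e -> approx_eig F lam d -> approx_eig F lam e.
Proof.
move=> de [v [vl v0 vd]]; exists v; split=> //.
by rewrite (le_trans vd)// lee_wpmul2r ?lee_fin// sqnorm_ge0.
Qed.

Lemma l2_resid F lam v c : koopman_bound F c -> l2 v -> l2 (resid F lam v).
Proof.
move=> Fc vl.
have -> : resid F lam v = (fun j => (v \o F) j + - lam * v j).
  by apply/funext => j; rewrite mulNr.
apply: l2D; last exact: l2Z.
exact: l2_le (Fc v vl) vl.
Qed.

Lemma Sp_apP F lam : bounded_on_l2 (koopman (R := R) F) ->
  Sp_ap (koopman F) lam <-> forall e, 0 < e -> approx_eig F lam e.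
Proof.
move=> /koopman_boundP[c c0 Fc]; split.
  move=> [u [u1 ulim]] e e0.
  have /cvgr_dist_lt/(_ (Num.sqrt e)) := ulim.
  rewrite sqrtr_gt0 e0 => /(_ isT)[n _ /(_ n (leqnn n))/=].
  rewrite sub0r normrN ger0_norm ?sqrtr_ge0// => une.
  have [unl un1] := u1 n.
  have S1 : sqnorm (u n) = 1%:E by rewrite (l2E unl) -l2norm_sqr un1 expr1n.
  exists (u n); split => //; first by rewrite S1 lte_fin.
  rewrite S1 mule1.
  have rl : l2 (resid F lam (u n)) by exact: l2_resid Fc unl.
  rewrite (l2E rl) lee_fin -l2norm_sqr -(sqr_sqrtr (ltW e0)).
  by rewrite ler_sqr ?nnegrE ?sqrtr_ge0 ?(ltW une).
move=> H.
have /choice[v vP] : forall n : nat, exists v : nat -> C, [/\ l2 v, (0 < sqnorm v)%E &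
    (sqnorm (resid F lam v) <= ((n.+1%:R^-1) ^+ 2)%:E * sqnorm v)%E].
  by move=> n; apply: H; rewrite exprn_gt0// invr_gt0.
have vl n : l2 (v n) by have [] := vP n.
have v0 n : 0 < fine (sqnorm (v n)) by have [+ + _] := vP n => /l2E ->.
pose a n : C := Complex (l2norm (v n))^-1 0.
have aE n : `|a n| ^+ 2 = (fine (sqnorm (v n)))^-1.
  by rewrite normC_real real_normK ?num_real// exprVn l2norm_sqr.
exists (fun n j => a n * v n j); split.
  move=> n; split; first exact: l2Z.
  rewrite /l2norm sqnormZ aE (l2E (vl n)) -EFinM/= mulVf ?sqrtr1//.
  by rewrite gt_eqF.
apply: (@squeeze_cvgr _ _ _ _ (fun _ => 0) (fun n => n.+1%:R^-1)); last 2 first.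
- exact: cvg_cst.
- exact: cvg_harmonic.
apply: nearW => n; rewrite sqrtr_ge0/=.
rewrite -ler_sqr ?nnegrE ?sqrtr_ge0 ?invr_ge0 ?ler0n//.
rewrite l2norm_sqr -lee_fin.
have rl : l2 (resid F lam (fun j => a n * v n j)) by apply: l2_resid Fc _; exact: l2Z.
rewrite -[leLHS](l2E rl) residZ sqnormZ aE.
have [_ _ vn] := vP n.
have rvl : l2 (resid F lam (v n)) by exact: l2_resid Fc (vl n).
move: vn; rewrite (l2E rvl) (l2E (vl n)) -!EFinM !lee_fin => vn.
by rewrite /= ler_pdivrMl// [leRHS]mulrC.
Qed.

(** Because T - mu = (T - lam) + (lam - mu). *)
Lemma approx_eig_shift F lam mu d e : 0 <= e -> `|lam - mu| ^+ 2 <= d ->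
  approx_eig F lam e -> approx_eig F mu (2 * e + 2 * d).
Proof.
move=> e0 lmd [v [vl v0 ve]]; exists v; split => //.
have -> : resid F mu v = (fun j => resid F lam v j + (lam - mu) * v j).
  by apply/funext => j; rewrite /resid mulrBl addrA subrK.
apply: le_trans (sqnormD _ _) _.
have rl : l2 (resid F lam v) := l2_le ve vl.
have s0 : 0 <= fine (sqnorm v) by rewrite fine_ge0// sqnorm_ge0.
have sd := ler_wpM2r s0 lmd.
rewrite sqnormZ; move: ve; rewrite (l2E rl) (l2E vl) -!EFinM -EFinD !lee_fin.
by move: sd; set t := `|_| ^+ 2 * _; lra.
Qed.

(** Because lam v = Tv - (T - lam)v. *)
Lemma approx_eig_bounded F lam c e : 0 <= e -> koopman_bound F c ->
  approx_eig F lam e -> `|lam| ^+ 2 <= 2 * c + 2 * e.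
Proof.
move=> e0 Fc [v [vl v0 ve]].
have rl := l2_resid lam Fc vl.
have Fvl : l2 (v \o F) by exact: l2_le (Fc v vl) vl.
have := @sqnorm_lin _ (fun j => lam * v j) (v \o F) (resid F lam v) 2 2.
rewrite sqnormZ; move: ve v0 (Fc v vl).
rewrite (l2E vl) (l2E rl) (l2E Fvl) -!EFinM -EFinD !lee_fin lte_fin.
move=> ve v0 Fve /(_ _ _ _)H.
have {}H : `|lam| ^+ 2 * fine (sqnorm v) <=
    2 * fine (sqnorm (v \o F)) + 2 * fine (sqnorm (resid F lam v)).
  apply: H => // j; rewrite -(normrN (resid _ _ _ _)).
  have -> : lam * v j = (v \o F) j + - resid F lam v j.
    by rewrite /resid opprB addrC subrK.
  exact: sqr_normC_add.
rewrite -(ler_pM2r v0); nra.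
Qed.

Lemma normC_le (a b : R) : `|Complex a b : C| <= `|a| + `|b|.
Proof.
rewrite -ler_sqr ?nnegrE ?addr_ge0// sqr_normC sqrrD !real_normK ?num_real//.
by rewrite addrAC lerDl mulrn_wge0// mulr_ge0.
Qed.

Lemma normC_Re (a b : R) : `|a| <= `|Complex a b : C|.
Proof.
by rewrite -ler_sqr ?nnegrE// sqr_normC real_normK ?num_real// lerDl sqr_ge0.
Qed.

Lemma normC_Im (a b : R) : `|b| <= `|Complex a b : C|.
Proof.
by rewrite -ler_sqr ?nnegrE// sqr_normC real_normK ?num_real// lerDr sqr_ge0.
Qed.

Lemma ComplexB (a b a' b' : R) :
  Complex a b - Complex a' b' = Complex (a - a') (b - b') :> C.
Proof. by []. Qed.

Lemma continuous_Complex : continuous (fun p : R * R => Complex p.1 p.2 : C).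
Proof.
move=> [a b]; apply/cvg_ballP => e e0.
have e20 : 0 < e / 2 by rewrite divr_gt0.
exists (ball a (e / 2), ball b (e / 2)); first by split; exact: nbhsx_ballx.
move=> [a' b'] [/= aa bb]; rewrite -ball_normE/= ComplexB.
rewrite (le_lt_trans (normC_le _ _))// [ltRHS]splitr.
by move: aa bb; rewrite -!ball_normE/= => aa bb; exact: ltrD.
Qed.

Lemma compactC (A : set C) (M : R) : closed A -> (forall z, A z -> `|z| <= M) ->
  compact A.
Proof.
move=> Acl AM.
apply: (@subclosed_compact _ _
  ((fun p : R * R => Complex p.1 p.2 : C) @` (`[- M, M] `*` `[- M, M]))) => //.
  apply: continuous_compact; last by apply: compact_setX; exact: segment_compact.
  exact: continuous_subspaceT continuous_Complex.
move=> [a b] /AM abM; exists (a, b) => //; split; rewrite /= in_itv/= -ler_norml.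
- exact: le_trans (normC_Re a b) abM.
- exact: le_trans (normC_Im a b) abM.
Qed.

Lemma closed_disc (M : R) : closed [set z : C | `|z| <= M].
Proof.
move=> z zcl; apply/ler_addgt0Pr => e e0.
have [y [yM]] := zcl _ (nbhsx_ballx z e e0).
rewrite -ball_normE/= => /ltW zy; rewrite -[z](subrK y) addrC.
by rewrite (le_trans (ler_normD _ _))// lerD.
Qed.

Lemma closed_far (A : compacts R) (e : R) : closed [set z : C | e <= dist_to z A].
Proof.
move=> z zcl; apply/ler_addgt0Pr => d d0.
have [y [ey]] := zcl _ (nbhsx_ballx z d d0).
rewrite -ball_normE/= distrC => /ltW zy.
by rewrite (le_trans ey)// (le_trans (dist_to_lip y z _))// addrC lerD2l.
Qed.

Lemma Sp_ap_closed F : bounded_on_l2 (koopman (R := R) F) ->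
  closed (Sp_ap (koopman (R := R) F)).
Proof.
move=> Fb z zcl; apply/(Sp_apP z Fb) => e e0.
have d0 : 0 < Num.sqrt (e / 4) by rewrite sqrtr_gt0 divr_gt0.
have [w [/(Sp_apP w Fb) wS]] := zcl _ (nbhsx_ballx z _ d0).
rewrite -ball_normE/= => zw.
have -> : e = 2 * (e / 4) + 2 * (e / 4) by lra.
have e40 : 0 < e / 4 by rewrite divr_gt0.
apply: (@approx_eig_shift F w z _ _ (ltW e40)) (wS _ e40).
rewrite -(sqr_sqrtr (ltW e40)) ler_sqr ?nnegrE// distrC; exact: ltW.
Qed.

Lemma Sp_ap_bounded F c lam : 0 < c -> koopman_bound F c ->
  Sp_ap (koopman (R := R) F) lam -> `|lam| ^+ 2 <= 2 * c.
Proof.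
move=> c0 Fc.
have Fb : bounded_on_l2 (koopman (R := R) F) by apply/koopman_boundP; exists c.
move=> /(Sp_apP lam Fb) Sl; apply/ler_addgt0Pr => e e0.
have e20 : 0 < e / 2 by rewrite divr_gt0.
have := approx_eig_bounded (ltW e20) Fc (Sl _ e20).
by rewrite [2 * (e / 2)]mulrCA divff// mulr1.
Qed.

Lemma Sp_ap_compact F : bounded_on_l2 (koopman (R := R) F) ->
  compact (Sp_ap (koopman (R := R) F)).
Proof.
move=> Fb; have /koopman_boundP[c c0 Fc] := Fb.
apply: (@compactC _ (Num.sqrt (2 * c))); first exact: Sp_ap_closed.
move=> z /(Sp_ap_bounded c0 Fc) zc; rewrite -ler_sqr ?nnegrE ?sqrtr_ge0//.
by rewrite sqr_sqrtr// mulr_ge0// ltW.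
Qed.

End Spectrum.

(** * Growth of positive sequences *)

Section Growth.
Variable R : realType.
Implicit Types (a b : nat -> R) (r rho c eta D : R).

Lemma exists_expr_lt (q e : R) m : 0 <= q < 1 -> 0 < e ->
  exists2 n, (m < n)%N & q ^+ n < e.
Proof.
move=> /andP[q0 q1] e0.
have /cvgr_dist_lt/(_ _ e0)[n _ nP] : q ^+ k @[k --> \oo] --> (0 : R).
  by apply: cvg_expr; rewrite ger0_norm.
exists (maxn m.+1 n); first exact: leq_maxl.
have := nP _ (leq_maxr m.+1 n).
by rewrite /= sub0r normrN ger0_norm// exprn_ge0.
Qed.

(** Let R_t be the sum of b over t <= k < n. The hypothesis reads
    R_t <= D (R_t - R_(t+1)) + D b_n, so R contracts by the factor 1 - 1/D up
    to the end term, and n is chosen so that this term is negligible. *)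
Lemma two_sided_decay b D s : 1 < D -> (forall k, 0 <= b k) ->
  (forall s n, (s <= n)%N -> \sum_(s <= k < n) b k <= D * (b s + b n)) ->
  (forall e, 0 < e -> exists2 n, (s < n)%N & b n < e) ->
  b s <= (D * (b 0%N + 2)) * (1 - D^-1) ^+ s.
Proof.
move=> D1 b0 bD bs.
have [q qE] : exists q, q = 1 - D^-1 by exists (1 - D^-1).
rewrite -qE.
have D0 : 0 < D by lra.
have DV : 0 < D^-1 < 1 by rewrite invr_gt0 D0 invf_lt1.
have q0 : 0 < q by rewrite qE; lra.
have DK : D * D^-1 = 1 by rewrite divff// gt_eqF.
have [n sn bn] := bs _ (exprn_gt0 s q0).
have q1 : q ^+ s <= 1 by rewrite exprn_ile1// ?(ltW q0)// qE; lra.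
have H t : (t <= s)%N -> \sum_(t <= k < n) b k <=
    q ^+ t * (\sum_(0 <= k < n) b k) + D * b n.
  elim: t => [_|t IH ts].
    by rewrite expr0 mul1r lerDl mulr_ge0// (ltW D0).
  have tn : (t < n)%N by exact: ltn_trans ts sn.
  have := IH (ltnW ts); have := bD t n (ltnW tn).
  rewrite big_ltn// exprS; set S0 := \sum_(0 <= k < n) _.
  set S1 := \sum_(t.+1 <= k < n) _.
  have : 0 <= q ^+ t * S0 by rewrite mulr_ge0 ?exprn_ge0 ?(ltW q0)// sumr_ge0.
  rewrite -mulrA; move: (q ^+ t * S0) (b0 t) (b0 n) => X.
  move: D1 D0 DV DK => D1' D0' /andP[V0 V1] DK.
  move=> h1 h2 h3 h4 h5.
  have h6 : D^-1 * (b t + S1) <= b t + b n.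
    by have := ler_wpM2l (ltW V0) h4; rewrite mulrA [_ * D]mulrC DK mul1r.
  have h7 := ler_wpM2l (ltW q0) h5.
  have h8 : q * (D * b n) = D * b n - b n.
    by rewrite qE mulrBl mul1r mulrA [_ * D]mulrC DK mul1r.
  by move: h6 h7 h8; rewrite qE; move: D^-1 => V; lra.
have := H s (leqnn s); have := bD 0%N n (leq0n n).
rewrite (big_ltn sn).
have : 0 <= \sum_(s.+1 <= k < n) b k by rewrite sumr_ge0.
move: (\sum_(_ <= k < _) b k) (\sum_(_ <= k < _) b k) => X Y.
move: (b0 0%N) (b0 n) bn q1 (exprn_gt0 s q0).
move: (q ^+ s) (b 0%N) (b n) (b s) => u b00 bn bss h1 h2 h3 h4 h5 h6 h7 h8.
have h9 : D * (b00 + bn) <= D * (b00 + 1) by apply: ler_wpM2l; lra.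
have h10 : u * X <= u * (D * (b00 + 1)) by apply: ler_wpM2l; lra.
have h11 : D * bn <= D * u by apply: ler_wpM2l; lra.
lra.
Qed.

(** If a_k = O(rho^k), take r = (1 + 1/D) rho. Then b_k = a_k r^-k tends to 0,
    hence decays like (1 - 1/D)^k by two_sided_decay, and this means that
    a_k = O((theta rho)^k) with theta = 1 - 1/D^2. Starting from rho = c, the
    rate drops below 1 after finitely many rounds, against 1 <= a_k. *)
Lemma no_two_sided_growth a c eta M : 0 < eta ->
  1 <= c -> 2 * c <= M ->
  (forall k, 1 <= a k <= c ^+ k) ->
  (forall r s n, 0 < r <= M -> (s <= n)%N ->
     eta * \sum_(s <= k < n) a k * r ^- k <=
     2 * r * (a n * r ^- n + a s * r ^- s)) ->
  False.
Proof.
move=> eta0 c1 cM a1 aeta.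
(* D dominates 2 r / eta for all the radii r <= 2 c that occur. *)
pose D := 4 * c / eta + 2.
have c0 : 0 < c by lra.
have D2 : 2 <= D by rewrite /D lerDr divr_ge0 ?mulr_ge0 ?ltW.
have D0 : 0 < D by lra.
have DV : 0 < D^-1 < 1 by rewrite invr_gt0 D0 invf_lt1//; lra.
have /andP[DV0 DV1] := DV.
have DVK : D * D^-1 = 1 by rewrite divff// gt_eqF.
pose theta := (1 - D^-1) * (1 + D^-1).
have theta01 : 0 < theta < 1 by rewrite /theta; apply/andP; split; nra.
have /andP[th0 th1] := theta01.
have step rho : 0 < rho <= c ->
    (exists2 B, 0 < B & forall k, a k <= B * rho ^+ k) ->
    exists2 B, 0 < B & forall k, a k <= B * (theta * rho) ^+ k.
  move=> /andP[rho0 rhoc] [B B0 aB].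
  pose r := (1 + D^-1) * rho.
  have r0 : 0 < r by rewrite /r mulr_gt0//; lra.
  have rc : r <= 2 * c by rewrite /r; nra.
  pose b k := a k * r ^- k.
  have rk0 k : 0 < r ^+ k by exact: exprn_gt0.
  have b0 k : 0 <= b k.
    rewrite /b divr_ge0 ?(ltW (rk0 k))//.
    by have /andP[+ _] := a1 k; apply: le_trans.
  exists (D * (b 0%N + 2)); first by rewrite mulr_gt0//; have := b0 0%N; lra.
  move=> s.
  have -> : (theta * rho) ^+ s = (1 - D^-1) ^+ s * r ^+ s.
    by rewrite -exprMn /theta /r mulrA.
  rewrite mulrA -ler_pdivrMr//.
  apply: (@two_sided_decay b D s _ b0).
  - by lra.
  - move=> t n tn.
    have r2 : 0 < r <= M by rewrite r0/=; lra.
    have := aeta r t n r2 tn; rewrite -ler_pdivlMl// => /le_trans; apply.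
    rewrite -/(b n) -/(b t) addrC mulrA ler_wpM2r ?addr_ge0//.
    rewrite /D mulrC [_ / eta]mulrC -ler_pdivlMl ?invr_gt0// invrK.
    rewrite mulrDr [eta * (_ / _)]mulrCA divff ?gt_eqF// mulr1.
    have := ltW eta0; lra.
  - move=> e e0.
    pose q := (1 + D^-1)^-1.
    have q01 : 0 <= q < 1 by rewrite /q; apply/andP; split; [rewrite invr_ge0 | rewrite invf_lt1]; lra.
    have [n sn qn] := exists_expr_lt s q01 (divr_gt0 e0 B0).
    exists n => //; rewrite /b ltr_pdivrMr//.
    apply: le_lt_trans (aB n) _.
    have -> : rho ^+ n = q ^+ n * r ^+ n.
      by rewrite -exprMn /q /r mulrA mulVf ?mul1r// gt_eqF//; lra.
    rewrite mulrA ltr_pM2r// mulrC -ltr_pdivlMr//.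
have all_i i : exists2 B, 0 < B & forall k, a k <= B * (theta ^+ i * c) ^+ k.
  elim: i => [|i IH].
    by exists 1 => // k; rewrite expr0 !mul1r; have /andP[] := a1 k.
  rewrite exprS -mulrA; apply: step IH.
  by rewrite mulr_gt0 ?exprn_gt0//= ler_piMl ?(ltW c0)// exprn_ile1 ?(ltW th0) ?(ltW th1).
have th01 : 0 <= theta < 1 by rewrite (ltW th0).
have [i _ thi] := exists_expr_lt 0 th01 (divr_gt0 ltr01 c0).
have [B B0 aB] := all_i i.
have rho01 : 0 <= theta ^+ i * c < 1.
  by rewrite -ltr_pdivlMr// thi andbT mulr_ge0 ?exprn_ge0 ?(ltW th0) ?(ltW c0).
have [k _ kB] := exists_expr_lt 0 rho01 (divr_gt0 ltr01 B0).
have /andP[+ _] := a1 k; apply/negP; rewrite -ltNge.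
by apply: le_lt_trans (aB k) _; rewrite mulrC -ltr_pdivlMr.
Qed.

End Growth.

(** * The approximate point spectrum is not empty *)

Section Nonempty.
Variable R : realType.
Local Notation C := (Rcomplex R).
Implicit Types (F : nat -> nat) (x u v : nat -> C) (lam mu : C) (c e d : R).

(** Not being an approximate eigenvalue is stable under small changes of lam and
    e by approx_eig_shift, so a common e exists by compactness. *)
Lemma compact_not_approx_eig F (K : set C) : compact K ->
  (forall lam, K lam -> exists2 e, 0 < e & ~ approx_eig F lam e) ->
  exists2 e, 0 < e & forall lam, K lam -> ~ approx_eig F lam e.
Proof.
move=> /compact_near_coveringP Kc KF.
have H : \forall e \near (0 : R)^'+, K `<=` (fun lam => ~ approx_eig F lam e).
  apply: Kc => lam Kl.
  have [e e0 ne] := KF _ Kl.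
  have e40 : 0 < e / 4 by rewrite divr_gt0.
  have s0 : 0 < Num.sqrt (e / 4) by rewrite sqrtr_gt0.
  exists (ball lam (Num.sqrt (e / 4)), [set d | 0 < d < e / 4]).
    split; first exact: nbhsx_ballx.
    near=> d; apply/andP; split => /=; near: d; first exact: nbhs_right_gt.
    exact: nbhs_right_lt.
  move=> [mu d] [/= lmu /andP[d0 de]] md; apply: ne.
  have : approx_eig F lam (2 * d + 2 * (e / 4)).
    apply: approx_eig_shift md; first exact: ltW.
    rewrite -[leRHS]sqr_sqrtr ?(ltW e40)// ler_sqr ?nnegrE//.
    by move: lmu; rewrite -ball_normE/= distrC => /ltW.
  by apply: approx_eig_le; lra.
have : \forall e \near 0^'+, 0 < e /\ K `<=` (fun lam => ~ approx_eig F lam e).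
    near=> e; split; near: e => //; exact: nbhs_right_gt.
by move=> /filter_ex[e [e0 Ke]]; exists e.
Unshelve. all: by end_near. Qed.

Lemma Sp_ap_eigenvector F lam x (n : nat) :
  bounded_on_l2 (koopman (R := R) F) ->
  (forall j, (n <= j)%N -> x j = 0) -> (exists j, x j <> 0) ->
  (forall j, x (F j) = lam * x j) -> Sp_ap (koopman F) lam.
Proof.
move=> Fb xn [j xj] xF; apply/(Sp_apP lam Fb) => e e0; exists x.
have -> : resid F lam x = (fun j => 0 * x j).
  by apply/funext => i; rewrite /resid xF subrr mul0r.
split.
- by rewrite /l2/= (sqnorm_finsupp xn) ltry.
- apply: lt_le_trans (sqnorm_ge_at x j).
  by rewrite lte_fin exprn_gt0// normr_gt0; apply/eqP.
- rewrite sqnormZ normr0 expr0n mul0e mule_ge0 ?sqnorm_ge0//.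
  by rewrite lee_fin ltW.
Qed.

Lemma sqr_norm_sum_disjoint n (g : nat -> C) :
  (forall k l, g k <> 0 -> g l <> 0 -> k = l) ->
  `|\sum_(k < n) g k : C| ^+ 2 = \sum_(k < n) `|g k| ^+ 2.
Proof.
move=> g1; have [[k gk]|g0] := pselect (exists k : 'I_n, g k <> 0).
  have gl (l : 'I_n) : l != k -> g l = 0.
    by move=> /eqP lk; apply: contrapT => gl; apply/lk/val_inj/g1.
  rewrite (bigD1 k)//= [in LHS]big1 ?addr0 => [|l /gl//].
  by rewrite [RHS](bigD1 k)//= [X in _ + X]big1 ?addr0// => l /gl ->; rewrite normr0 expr0n.
have gl (l : 'I_n) : g l = 0 by apply: contrapT => gl; apply: g0; exists l.
by rewrite !big1 ?normr0 ?expr0n// => l _; rewrite gl// normr0 expr0n.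
Qed.

Section NonPeriodic.
Variables (F : nat -> nat) (c : R) (j : nat).
Hypotheses (c1 : 1 <= c) (Fc : koopman_bound F c).
Hypothesis F_surj : forall i, exists i', F i' = i.
Hypothesis j_aper : forall p, (0 < p)%N -> iter p F j <> j.

Let w k : nat -> C := fun i => if iter k F i == j then 1 else 0.

Let wS k : w k.+1 = w k \o F.
Proof. by apply/funext => i; rewrite /w/= -iterSr. Qed.

Let w0 : sqnorm (w 0) = 1%:E.
Proof.
rewrite (@sqnorm_finsupp _ _ j.+1) => [|i ji].
  rewrite big_ord_recr/= big1 ?add0r => [|i _]; rewrite /w/=.
    by rewrite eqxx normC1 expr1n.
  by rewrite ltn_eqF ?ltn_ord// normr0 expr0n.
by rewrite /w/= gtn_eqF.
Qed.

Let w_bound k : (sqnorm (w k) <= (c ^+ k)%:E)%E.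
Proof.
elim: k => [|k IH]; first by rewrite w0 expr0.
rewrite wS exprS EFinM; apply: le_trans (Fc _) _.
  by rewrite /l2/= (le_lt_trans IH)// ltry.
by rewrite lee_wpmul2l// lee_fin (le_trans ler01).
Qed.

Let wl k : l2 (w k).
Proof. by rewrite /l2/= (le_lt_trans (w_bound k))// ltry. Qed.

Let iter_surj k i : exists i', iter k F i' = i.
Proof.
elim: k => [|k [i' ki]]; first by exists i.
by have [i2 Fi2] := F_surj i'; exists i2; rewrite iterSr Fi2.
Qed.

Let w_ge1 k : 1 <= fine (sqnorm (w k)).
Proof.
rewrite -lee_fin -(l2E (wl k)); have [i ki] := iter_surj k j.
apply: le_trans (sqnorm_ge_at (w k) i).
by rewrite /w ki eqxx normC1 expr1n.
Qed.

Let w_disj k l i : w k i <> 0 -> w l i <> 0 -> k = l.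
Proof.
have sub p q : (p < q)%N -> iter p F i = j -> iter q F i = j -> False.
  move=> pq pj; rewrite -(subnK (ltnW pq)) iterD pj; apply: j_aper.
  by rewrite subn_gt0.
rewrite /w; case: eqP => // kj _; case: eqP => // lj _.
by apply/eqP; case: (ltngtP k l) => // h; exfalso; [exact: (sub k l)|exact: (sub l k)].
Qed.

(** The test vector is the sum of t^-k w_k over the window, where w_k is the
    indicator of the k-th iterated fibre over j. These fibres are disjoint
    because j is not periodic, which gives the squared norm; and since
    w_k o F = w_(k+1), the residual telescopes to the two ends. *)
Lemma aperiodic_window (eta t : R) s n : 0 < eta -> 0 < t -> (s <= n)%N ->
  ~ approx_eig F (Complex t 0) eta ->
  eta * \sum_(s <= k < n) fine (sqnorm (w k)) * (t ^+ 2) ^- k <=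
  2 * (t ^+ 2) * (fine (sqnorm (w n)) * (t ^+ 2) ^- n + fine (sqnorm (w s)) * (t ^+ 2) ^- s).
Proof.
move=> eta0 t0 sn nap.
set T : C := Complex t 0.
have TN : T != 0 by apply/eqP => -[/eqP]; rewrite gt_eqF.
have TV k : `|(T ^- k : C)| ^+ 2 = (t ^+ 2) ^- k.
  have TT : `|T ^+ k : C| = t ^+ k.
    elim: k => [|k IH]; first by rewrite !expr0 normC1.
    by rewrite !exprS normCM IH normC_real gtr0_norm.
  have : `|T ^+ k * T ^- k : C| = 1 by rewrite divff ?normC1// expf_neq0.
  rewrite normCM TT => /(canRL (mulKf _)) -> //; last by rewrite gt_eqF// exprn_gt0.
  by rewrite mulr1 exprVn -exprM mulnC exprM.
pose g k : nat -> C := fun i => T ^- (s + k) * w (s + k) i.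
pose u : nat -> C := fun i => \sum_(k < n - s) g k i.
have uE : sqnorm u = (\sum_(s <= k < n) fine (sqnorm (w k)) * (t ^+ 2) ^- k)%:E.
  rewrite sqnorm_esum (eq_esum (b := fun i => \sum_(k < n - s) (`|g k i| ^+ 2)%:E)%E).
    rewrite esum_sum; last by move=> i k _ _; rewrite lee_fin sqr_ge0.
    have -> (G : nat -> R) : \sum_(s <= k < n) G k = \sum_(k < n - s) G (k + s)%N.
      by rewrite -{1}(add0n s) big_addn big_mkord.
    rewrite -sumEFin.
    apply: eq_bigr => k _; rewrite -sqnorm_esum sqnormZ TV (l2E (wl _)).
    by rewrite -EFinM mulrC [(s + k)%N]addnC.
  move=> i _; rewrite sumEFin; congr EFin.
  apply: (@sqr_norm_sum_disjoint _ (fun k => g k i)) => k l gk gl.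
  apply/eqP; rewrite -(eqn_add2l s); apply/eqP/(@w_disj _ _ i) => wi.
    by apply: gk; rewrite /g wi mulr0.
  by apply: gl; rewrite /g wi mulr0.
have ul : l2 u by rewrite /l2/= uE ltry.
have uR : resid F T u =
    fun i => T * (T ^- n * w n i) + - T * (T ^- s * w s i).
  apply/funext => i; rewrite /resid /u mulr_sumr -sumrB.
  pose G k := T * (T ^- k * w k i).
  rewrite (eq_bigr (fun k : 'I_(n - s) => G (s + k).+1 - G (s + k)%N)); last first.
    move=> k _; rewrite /G /g; congr (_ - _).
    by rewrite wS/= exprS invfM mulrA mulrA divff// mul1r.
  rewrite -(big_mkord xpredT (fun k => G (s + k).+1 - G (s + k)%N)).
  rewrite (telescope_sumr_eq (fun k => G (s + k)%N))//.
    by rewrite subnKC// addn0 mulNr.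
  by move=> k _; rewrite addnS.
have rl := l2_resid T Fc ul.
have uRle : (sqnorm (resid F T u) <= (2 * (t ^+ 2) * (fine (sqnorm (w n)) *
    (t ^+ 2) ^- n + fine (sqnorm (w s)) * (t ^+ 2) ^- s))%:E)%E.
  rewrite uR; apply: le_trans (sqnormD _ _) _.
  rewrite !sqnormZ normrN !TV (l2E (wl n)) (l2E (wl s)) -!EFinM -EFinD lee_fin.
  rewrite normC_real real_normK ?num_real// le_eqVlt; apply/orP; left; apply/eqP.
  by ring.
rewrite leNgt; apply/negP => H; apply: nap; exists u; split => //.
- rewrite uE lte_fin -(pmulr_rgt0 _ eta0) (le_lt_trans _ H)//.
  by rewrite -lee_fin (le_trans _ uRle)// sqnorm_ge0.
- rewrite (le_trans uRle)// uE -EFinM lee_fin; exact: ltW.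
Qed.

Lemma aperiodic_approx (M eta : R) : 2 * c <= M ^+ 2 -> 0 <= M -> 0 < eta ->
  exists2 t, 0 < t <= M & approx_eig F (Complex t 0) eta.
Proof.
move=> cM M0 eta0; apply: contrapT => H.
apply: (@no_two_sided_growth R (fun k => fine (sqnorm (w k))) c eta (M ^+ 2)) => //.
- by move=> k; rewrite w_ge1/= -lee_fin -(l2E (wl k)).
- move=> r s n /andP[r0 rM] sn.
  have -> : r = Num.sqrt r ^+ 2 by rewrite sqr_sqrtr// ltW.
  apply: aperiodic_window => //; first by rewrite sqrtr_gt0.
  move=> ap; apply: H; exists (Num.sqrt r) => //.
  rewrite sqrtr_gt0 r0/= -ler_sqr ?nnegrE ?sqrtr_ge0// sqr_sqrtr// ltW//.
Qed.

End NonPeriodic.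

Lemma Sp_ap_nonempty F : bounded_on_l2 (koopman (R := R) F) ->
  Sp_ap (koopman (R := R) F) !=set0.
Proof.
move=> Fb; have /koopman_boundP[c c0 Fc] := Fb.
have [F_surj|[i iF]] : (forall i, exists i', F i' = i) \/ (exists i, forall i', F i' <> i).
- apply: contrapT => /not_orP[/existsNP[i /forallNP iF] /forallNP H].
  by apply: (H i).
- have [[j jper]|allper] := pselect (exists j, forall p, (0 < p)%N -> iter p F j <> j).
  + pose c' := Num.max 1 c.
    have c'1 : 1 <= c' by rewrite le_max lexx.
    have Fc' : koopman_bound F c'.
      move=> x xl; rewrite (le_trans (Fc x xl))// lee_wpmul2r ?sqnorm_ge0//.
      by rewrite lee_fin le_max lexx orbT.
    apply: contrapT => /set0P/negP/negPn/eqP Sp0.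
    pose K : set C := [set z | `|z| <= 2 * c'].
    have Kc : compact K.
      by apply: (@compactC _ _ (2 * c')) => //; exact: closed_disc.
    have [|eta eta0 nap] := compact_not_approx_eig Kc (F := F).
      move=> lam _; apply: contrapT => H.
      have : Sp_ap (koopman (R := R) F) lam; last by rewrite Sp0.
      apply/(Sp_apP lam Fb) => e e0; apply: contrapT => ne; apply: H.
      by exists e.
    have [||t /andP[t0 tM]] := aperiodic_approx c'1 Fc' F_surj jper (M := 2 * c') _ _ eta0.
    * by nra.
    * by rewrite mulr_ge0// (le_trans _ c'1).
    * by apply: nap; rewrite /K/= normC_real gtr0_norm.
  + have per j : exists2 p, (0 < p)%N & iter p F j = j.
      by apply: contrapT => H; apply: allper; exists j => p p0 pj; apply: H; exists p.
    exists 1; have [p p0 p0E] := per 0%N.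
    (* As all points are periodic, F j lies on the orbit of 0 only if j does. *)
    pose x : nat -> C := fun j => if `[< exists k, iter k F 0 = j >] then 1 else 0.
    have orbit_mod k : iter k F 0%N = iter (k %% p) F 0%N.
      rewrite {1}(divn_eq k p) addnC iterD; congr iter.
      by elim: (k %/ p)%N => //= q IH; rewrite mulSn iterD IH.
    apply: (@Sp_ap_eigenvector _ _ x (\sum_(k < p) iter k F 0%N).+1) => //.
    * move=> j jn; rewrite /x; case: asboolP => // -[k kj].
      move: jn; rewrite -kj orbit_mod ltnNge => /negP; case.
      by rewrite (bigD1 (Ordinal (ltn_pmod k p0)))//= leq_addr.
    * exists 0%N; rewrite /x; case: asboolP => [_|[]]; last by exists 0%N.
      by apply/eqP; exact: oner_neq0.
    * move=> j; rewrite mul1r /x; congr (if _ then _ else _).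
      apply/asboolP/asboolP => [[k kj]|[k kj]]; last by exists k.+1; rewrite iterS kj.
      have [[//|q] _ qj] := per j.
      by exists (q + k)%N; rewrite iterD kj -iterSr.
- exists 0; apply: (@Sp_ap_eigenvector _ _ (fun j => if j == i then 1 else 0) i.+1) => //.
  + by move=> j ij; rewrite gtn_eqF.
  + by exists i; rewrite eqxx; apply/eqP; exact: oner_neq0.
  + by move=> j; rewrite mul0r; case: eqP => // /iF.
Qed.

End Nonempty.

(** * Sequences tending to infinity and Baire category *)

Section Baire.
Local Open Scope nat_scope.
Implicit Types (x y : nat -> nat) (s sigma tau : seq nat).

Definition tends_to_infty x := forall k, exists m, forall n, m <= n -> k <= x n.

(** Openness in the product topology. *)
Definition prefix_open (O : set (nat -> nat)) :=
  forall x, O x -> exists N, forall y, (forall n, n < N -> y n = x n) -> O y.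

Definition extends sigma k x :=
  (forall i, i < size sigma -> x i = nth 0 sigma i) /\
  (forall i, size sigma <= i -> k <= x i).

(** The words grow by nonempty pieces, hence determine a sequence. *)
Lemma chain_limit (s : nat -> seq nat) (k : nat -> nat) :
  {homo k : i j / i <= j} ->
  (forall t, exists tau, [/\ s t.+1 = s t ++ tau, all (leq (k t)) tau & 0 < size tau]) ->
  exists x, forall t, extends (s t) (k t) x.
Proof.
move=> kmono sP.
have size_s t : t <= size (s t).
  elim: t => // t IH; have [tau [-> _ tau0]] := sP t.
  by rewrite size_cat -addn1 leq_add.
have sE t u : exists tau, s (t + u) = s t ++ tau /\ all (leq (k t)) tau.
  elim: u => [|u [tau [E kt]]]; first by exists [::]; rewrite addn0 cats0.
  have [tau' [E' kt' _]] := sP (t + u).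
  exists (tau ++ tau'); rewrite addnS E' E catA; split => //.
  rewrite all_cat kt/=; apply: sub_all kt' => i; apply: leq_trans.
  exact/kmono/leq_addr.
pose x i := nth 0 (s i.+1) i; exists x => t; split => i it.
  rewrite /x; have [ti|/ltnW ti] := leqP t i.+1.
    by have [tau [E _]] := sE t (i.+1 - t); rewrite -(subnKC ti) E nth_cat it.
  have [tau [E _]] := sE i.+1 (t - i.+1); rewrite -[in RHS](subnKC ti) E nth_cat.
  by rewrite size_s.
have ti : t <= i.+1.
  by rewrite ltnW// ltnS (leq_trans (size_s t)).
have [tau [E kt]] := sE t (i.+1 - t); rewrite /x -(subnKC ti) E nth_cat ltnNge it/=.
apply: (allP kt); apply: mem_nth.
have := size_s i.+1; rewrite -{2}(subnKC ti) E size_cat => h.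
by rewrite ltn_subLR.
Qed.

Lemma extends_rcons sigma k x l : extends (rcons sigma l) k x -> k <= l ->
  extends sigma k x.
Proof.
move=> [x1 x2] kl; split=> i; last first.
  rewrite leq_eqVlt => /predU1P[<-|si]; last by apply: x2; rewrite size_rcons.
  by rewrite x1 ?size_rcons// nth_rcons ltnn eqxx.
by move=> si; rewrite x1 ?nth_rcons ?si// size_rcons ltnS ltnW.
Qed.

(** A fusion argument. A stage consists of a finite word and a lower bound k on
    all later letters. If no extension of a stage with later bound k + 1 could
    leave the M-th countable intersection, one could enter all its open sets
    in turn while writing k infinitely often; the limit would belong to it
    without tending to infinity. So each stage has an extension that leaves
    the M-th intersection, and the limit of these stages tends to infinity
    but belongs to none of these intersections. *)
Lemma tends_to_infty_not_Gdelta_sigma (O : nat -> nat -> set (nat -> nat)) :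
  (forall M t, prefix_open (O M t)) ->
  (forall x, tends_to_infty x <-> exists M, forall t, O M t x) -> False.
Proof.
move=> Oo OP.
have claim M k sigma : exists tau, all (leq k) tau /\
    exists t, forall x, extends (sigma ++ tau) k.+1 x -> ~ O M t x.
  apply: contrapT => H.
  have step st : exists tau, (exists tau0, st.1 = sigma ++ tau0 /\ all (leq k) tau0) ->
      [/\ all (leq k) tau, last k.+1 tau = k, 0 < size tau &
      forall y, (forall i, i < size (st.1 ++ tau) -> y i = nth 0 (st.1 ++ tau) i) -> O M st.2 y].
    case: st => s t /=.
    have [[tau0 [-> ktau0]]|ns] := pselect
      (exists tau0, s = sigma ++ tau0 /\ all (leq k) tau0); last by exists [::].
    have [x [[x1 x2] Ox]] : exists x, extends (sigma ++ tau0) k.+1 x /\ O M t x.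
      apply: contrapT => nx; apply: H; exists tau0; split => //; exists t => x ex Ox.
      by apply: nx; exists x.
    have [N NO] := Oo _ _ _ Ox.
    set m := size (sigma ++ tau0) in x1 x2.
    (* The prefix of x decides membership; the final letter k makes k occur
       infinitely often in the limit. *)
    exists (rcons (mkseq (fun i => x (m + i)) N) k) => _; split.
    - rewrite all_rcons leqnn/=; apply/allP => _ /mapP[i _ ->].
      by rewrite ltnW// x2// leq_addr.
    - by rewrite last_rcons.
    - by rewrite size_rcons.
    move=> y; rewrite size_cat size_rcons size_mkseq -/m => yE; apply: NO => n nN.
    rewrite yE ?addnS ?ltnS ?(leq_trans (ltnW nN)) ?leq_addl//.
    rewrite nth_cat -/m; case: ltnP => [/x1 ->//|mn].
    have nmN : n - m < N by rewrite (leq_ltn_trans _ nN)// leq_subr.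
    by rewrite nth_rcons size_mkseq nmN nth_mkseq// subnKC.
  have [f fP] := choice step.
  pose s := fix s t := if t is t'.+1 then s t' ++ f (s t', t') else sigma.
  have good t : exists tau0, s t = sigma ++ tau0 /\ all (leq k) tau0.
    elim: t => [|t [tau0 [E k0]]]; first by exists [::]; rewrite cats0.
    have [|kf _ _ _] := fP (s t, t); first by exists tau0.
    by exists (tau0 ++ f (s t, t)); rewrite /= all_cat k0 kf E catA.
  have [|t|x xP] := @chain_limit s (fun=> k) => //.
    by have [kf _ f0 _] := fP (s t, t) (good t); exists (f (s t, t)).
  have xO t : O M t x.
    have [_ _ _ fO] := fP (s t, t) (good t); apply: fO.
    by have [+ _] := xP t.+1.
  have /(OP x)/(_ k.+1)[m mP] : exists M, forall t, O M t x by exists M.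
  have szs t : t <= size (s t).
    elim: t => //= t IH; have [_ _ f0 _] := fP (s t, t) (good t).
    by rewrite size_cat -addn1 leq_add.
  have := mP (size (s m.+1)).-1; rewrite -ltnS prednK ?szs; last first.
    exact: leq_trans (szs _).
  have [x1 _] := xP m.+1; rewrite x1; last by rewrite prednK// (leq_trans _ (szs _)).
  have [_ fk f0 _] := fP (s m, m) (good m).
  rewrite nth_last/= last_cat; case: (f _) fk f0 => //= a l -> _ => /(_ isT).
  by rewrite ltnn.
have step (sM : seq nat * nat) : exists tau, [/\ all (leq sM.2) tau, 0 < size tau &
    exists t, forall x, extends (sM.1 ++ tau) sM.2.+1 x -> ~ O sM.2 t x].
  have [tau [kt [t tP]]] := claim sM.2 sM.2 sM.1.
  (* One more letter makes the extension nonempty. *)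
  exists (rcons tau sM.2.+1); rewrite all_rcons leqnSn size_rcons; split=> //.
  exists t => x; rewrite -rcons_cat => xe; apply: tP.
  exact: extends_rcons xe _.
have [f fP] := choice step.
pose s := fix s t := if t is t'.+1 then s t' ++ f (s t', t') else [::].
have [|t|x xP] := @chain_limit s id => //.
  by have [kf f0 _] := fP (s t, t); exists (f (s t, t)).
have /(OP x)[M MO] : tends_to_infty x.
  by move=> k; exists (size (s k)); have [_] := xP k.
have [_ _ [t tP]] := fP (s M, M).
exact: (tP x (xP M.+1)).
Qed.

End Baire.

(** * A map encoding a sequence of naturals *)

Section Graph.
Local Open Scope nat_scope.
Implicit Types (x y : nat -> nat).

Definition tree (w : nat) := w.*2.
(** The triple (r, s, l) is the link with r links after it and l before it in a
    chain of length r + l + 1 that starts at time s. *)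
Definition link (c : nat * nat * nat) := (pickle c).*2.+1.
Definition unlink (j : nat) : option (nat * nat * nat) := pickle_inv j./2.

(** Only the first n is recognized, so that a link gets at most two preimages
    from the trees. *)
Definition first_hit x (k s n : nat) : bool :=
  [&& s <= n, x n <= k & [forall i : 'I_n, (s <= i) ==> (k < x i)]].

(** The four tree vertices w with w / 4 = q lie over q. The last two of them may
    move: if q codes a link and the time at which its chain is first hit, they
    are mapped to that link. The other two keep every tree vertex doubly
    covered. The last link of a chain is mapped to a tree vertex of its own. *)
Definition graph x (j : nat) : nat :=
  if odd j then
    if unlink j is Some (r.+1, s, l) then link (r, s, l.+1) else tree j./2
  else let q := j./2 %/ 4 in
    if j./2 %% 4 < 2 then tree q
    else if pickle_inv q is Some (r, s, l, n) then
      if first_hit x (r + l) s n then link (r, s, l) else tree q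
    else tree q.

(** This class and the image together determine a vertex, so the fibres have at
    most five elements. *)
Definition graph_class (j : nat) : nat := if odd j then 4 else j./2 %% 4.

Lemma odd_tree w : odd (tree w) = false. Proof. by rewrite /tree odd_double. Qed.
Lemma odd_link c : odd (link c). Proof. by rewrite /link/= odd_double. Qed.
Lemma tree_inj : injective tree. Proof. exact: double_inj. Qed.
Lemma link_inj : injective link.
Proof. by move=> c d [] /double_inj /(pcan_inj pickleK_inv). Qed.
Lemma linkK c : unlink (link c) = Some c.
Proof. by rewrite /unlink /link/= uphalf_double pickleK_inv. Qed.
Lemma unlinkK j c : odd j -> unlink j = Some c -> j = link c.
Proof.
move=> oj; rewrite /unlink /link => jc.
have := @pickle_invK (nat * nat * nat)%type j./2; rewrite jc/= => ->.
by rewrite -[LHS]odd_double_half oj add1n.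
Qed.
Lemma treeE j : ~~ odd j -> j = tree j./2.
Proof. by move=> /negbTE oj; rewrite -[LHS]odd_double_half oj. Qed.

Lemma tree_link w c : tree w <> link c.
Proof. by move=> /(congr1 odd); rewrite odd_tree odd_link. Qed.

Lemma first_hit_uniq x k s m n : first_hit x k s m -> first_hit x k s n -> m = n.
Proof.
have sub a b : a < b -> first_hit x k s a -> first_hit x k s b -> False.
  move=> ab /and3P[sa xa _] /and3P[_ _ /forallP/(_ (Ordinal ab))].
  by rewrite /= sa/= ltnNge xa.
by move=> hm hn; case: (ltngtP m n) => // h; exfalso; [exact: sub hm hn|exact: sub hn hm].
Qed.

Lemma graph_link x r s l :
  graph x (link (r, s, l)) =
  if r is r'.+1 then link (r', s, l.+1) else tree (pickle (r, s, l)).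
Proof.
rewrite /graph odd_link linkK; case: r => // .
by rewrite /link/= uphalf_double.
Qed.

Lemma graph_class_lt j : graph_class j < 5.
Proof. by rewrite /graph_class; case: ifP => // _; rewrite ltnW// ltnS ltn_mod. Qed.

Lemma graph_inj x i j :
  graph_class i = graph_class j -> graph x i = graph x j -> i = j.
Proof.
rewrite /graph_class; case: ifP => oi; case: ifP => oj.
- have half_inj : i./2 = j./2 -> i = j.
    by move=> ij; rewrite -(odd_double_half i) -(odd_double_half j) oi oj ij.
  move=> _; rewrite /graph oi oj.
  case ui : (unlink i) => [[[[|r] s] l]|];
    case uj : (unlink j) => [[[[|r'] s'] l']|];
    do ?[by move/tree_link | by move/esym/tree_link |
         by move=> /tree_inj; exact: half_inj].
  move=> /link_inj[rE sE lE]; rewrite (unlinkK oi ui) (unlinkK oj uj).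
  by rewrite rE sE lE.
- by move=> h; have := ltn_pmod j./2 (isT : 0 < 4); rewrite -h.
- by move=> h; have := ltn_pmod i./2 (isT : 0 < 4); rewrite h.
- move=> m4; rewrite /graph oi oj m4.
  have done : i./2 %/ 4 = j./2 %/ 4 -> i = j.
    move=> d4; rewrite -(odd_double_half i) -(odd_double_half j) oi oj.
    by rewrite (divn_eq i./2 4) (divn_eq j./2 4) m4 d4.
  case: ifP => _; first by move=> /tree_inj/done.
  move=> h; apply: done; move: h.
  have := @pickle_invK (nat * nat * nat * nat)%type (i./2 %/ 4).
  have := @pickle_invK (nat * nat * nat * nat)%type (j./2 %/ 4).
  case: (pickle_inv (i./2 %/ 4)) => [[[[r s] l] n]|] /=;
    case: (pickle_inv (j./2 %/ 4)) => [[[[r' s'] l'] n']|] /=;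
    do ?[case: ifP => h1]; do ?[case: ifP => h2];
    do ?[by move=> *; apply: tree_inj | by move=> _ _ /tree_link |
         by move=> _ _ /esym/tree_link].
  move=> <- <- /link_inj[rE sE lE]; rewrite rE sE lE in h1 *.
  by rewrite (first_hit_uniq h1 h2).
Qed.

(** A tree vertex inspects x only up to the time n that its code names. *)
Lemma graph_continuous x j : exists N, forall y,
  (forall n, n < N -> y n = x n) -> graph y j = graph x j.
Proof.
rewrite /graph; case: ifP => _; first by exists 0.
case: ifP => _; first by exists 0.
case: pickle_inv => [[[[r s] l] n]|]; last by exists 0.
exists n.+1 => y yx; congr (if _ then _ else _).
rewrite /first_hit yx//; congr [&& _, _ & _].
by apply: eq_forallb => i; rewrite yx// ltnS ltnW.
Qed.

Lemma graph_tree x q e : e < 4 -> graph x (tree (q * 4 + e)) =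
  if e < 2 then tree q
  else if pickle_inv q is Some (r, s, l, n) then
    if first_hit x (r + l) s n then link (r, s, l) else tree q
  else tree q.
Proof.
move=> e4; rewrite /graph odd_tree /tree doubleK divnMDl// modnMDl.
by rewrite divn_small// addn0 modn_small.
Qed.

(** Tree vertices and links of chains that are hit at some time: every vertex of
    this set has two preimages in it, so T is expanding there. *)
Definition doubled x : set nat := [set j | ~~ odd j \/
  exists2 c, j = link c & exists n, first_hit x (c.1.1 + c.2) c.1.2 n].

Lemma doubled_preimages x i : doubled x i -> exists w,
  graph x (tree w.*2) = i /\ graph x (tree w.*2.+1) = i.
Proof.
move=> [ei|[[[r s] l] -> /= [n hn]]].
  exists (i./2).*2; rewrite [RHS in _ /\ _ = RHS](treeE ei) [X in _ = X /\ _](treeE ei).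
  rewrite [_.*2.*2](_ : _ = i./2 * 4 + 0); last by lia.
  by rewrite -addnS !graph_tree.
exists (pickle (r, s, l, n)).*2.+1.
rewrite [_.*2](_ : _ = pickle (r, s, l, n) * 4 + 2); last by lia.
by rewrite -addnS !graph_tree//= pickleK_inv hn.
Qed.

End Graph.

(** * The spectrum near 1 of the encoding map *)

Section GraphSpectrum.
Variable R : realType.
Local Notation C := (Rcomplex R).
Implicit Types (x : nat -> nat) (v : nat -> C).

Lemma graph_bounded x : bounded_on_l2 (koopman (R := R) (graph x)).
Proof.
apply/koopman_boundP; exists 5%:R => // v _.
apply: sqnorm_classes graph_class_lt _; exact: graph_inj.
Qed.

Definition graphN x : OmegaN R := exist _ (graph x) (graph_bounded x).

Lemma sqnorm_on_injective (n : nat) (h : nat -> nat) v :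
  {in [set i | (i < n)%N] &, injective h} ->
  ((\sum_(i < n) `|v (h i)| ^+ 2)%:E <= sqnorm v)%E.
Proof.
move=> hi; rewrite -[leRHS](congr1 (@sqnorm R) (cutoff_setT v)).
apply: le_trans (@sqnorm_inj _ [set i | (i < n)%N] setT h v hi _) => //.
rewrite (@sqnorm_finsupp _ _ n) => [|j nj]; last first.
  by rewrite cutoff_out//= ltnNge nj.
by rewrite lee_fin; apply: ler_sum => i _; rewrite cutoff_in/=.
Qed.

(** The indicator of a chain that is never hit is invariant except at the last
    link, so its residual has squared norm 1, to be compared with the length of
    the chain. *)
Lemma graph_Sp_ap1 x : tends_to_infty x ->
  Sp_ap (koopman (R := R) (graph x)) 1.
Proof.
move=> xoo; apply/(Sp_apP 1 (graph_bounded x)) => e e0.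
have [k ke] : exists k : nat, 1 <= e * k.+1%:R.
  exists (Num.bound e^-1); rewrite mulrC -ler_pdivrMr// div1r.
  have eV : 0 <= e^-1 by rewrite invr_ge0 ltW.
  by rewrite (le_trans (ltW (archi_boundP eV)))// ler_nat.
have [s sP] := xoo k.+1.
have alive r l n : (r + l = k)%N -> ~ first_hit x (r + l) s n.
  by move=> -> /and3P[sn]; rewrite leqNgt (sP _ sn).
pose h r := link (r, s, (k - r)%N).
have h_inj : {in [set i | (i < k.+1)%N] &, injective h}.
  by move=> r r' _ _ /link_inj[].
pose A : set nat := h @` [set i | (i < k.+1)%N].
pose v : nat -> C := cutoff A (fun=> 1).
have vh r : (r <= k)%N -> v (h r) = 1.
  by move=> rk; rewrite /v cutoff_in//; exists r.
have vl : l2 v.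
  rewrite /l2/= (@sqnorm_finsupp _ _ (\sum_(r < k.+1) h r).+1) ?ltry// => j hj.
  rewrite /v cutoff_out// => -[r /= rk rj]; move: hj; rewrite -rj.
  by rewrite (bigD1 (Ordinal rk))//= ltnNge leq_addr.
have vS : ((k.+1%:R)%:E <= sqnorm v)%E.
  apply: le_trans (sqnorm_on_injective v h_inj).
  rewrite lee_fin (eq_bigr (fun=> 1)) => [|r _].
    by rewrite sumr_const card_ord.
  by rewrite vh ?normC1 ?expr1n// -ltnS.
exists v; split=> //; first by apply: lt_le_trans vS; rewrite lte_fin.
apply: (@le_trans _ _ 1%:E); last first.
  apply: (@le_trans _ _ (e%:E * (k.+1%:R)%:E)%E); first by rewrite -EFinM lee_fin.
  by rewrite lee_wpmul2l// lee_fin ltW.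
have res j : resid (graph x) 1 v j = if j == h 0 then -1 else 0.
  rewrite /resid mul1r; case: eqP => [->|jh].
    rewrite vh// /h graph_link /v cutoff_out ?sub0r// => -[r _ ].
    by move=> /esym/tree_link.
  have [[r /= rk rj]|nA] := pselect (A j).
    rewrite -rj vh//; case: r => [|r] in rk rj *; first by rewrite -rj in jh.
    rewrite /h graph_link (_ : (k - r.+1).+1 = k - r)%N; last by lia.
    by rewrite -/(h r) vh ?subrr// ltnW.
  rewrite [in X in _ - X]/v (cutoff_out _ nA) subr0 /v cutoff_out// => -[r /= rk].
  rewrite /graph; case: ifP => oj.
    case uj : (unlink j) => [[[[|r'] s'] l']|]; try by move/esym/tree_link.
    move=> /link_inj[rE sE lE]; apply: nA; exists r'.+1; last first.
      by rewrite (unlinkK oj uj) /h -sE; congr link; congr (_, _); lia.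
    rewrite /= ltnS; lia.
  case: ifP => _; first by move/esym/tree_link.
  case: pickle_inv => [[[[r' s'] l'] n]|]; last by move/esym/tree_link.
  case: ifP => [hit|_]; last by move/esym/tree_link.
  move=> /link_inj[rE sE lE]; rewrite -rE -sE -lE in hit.
  by apply: (@alive r (k - r)%N n _ hit); rewrite subnKC.
have -> : sqnorm (resid (graph x) 1 v) = 1%:E; last by [].
rewrite (@sqnorm_finsupp _ _ (h 0).+1) => [|j hj]; last by rewrite res gtn_eqF.
rewrite big_ord_recr/= big1 ?add0r => [|i _].
  by rewrite res eqxx normrN normC1 expr1n.
by rewrite res ltn_eqF ?ltn_ord// normr0 expr0n.
Qed.

(** The two preimages of a vertex are told apart by the parity of their tree
    index, so the two contributions add up. *)
Lemma sqnorm_doubled x v :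
  (2%:E * sqnorm (cutoff (doubled x) v) <=
   sqnorm (cutoff (doubled x) (v \o graph x)))%E.
Proof.
have /choice[w wP] : forall i, exists w, doubled x i ->
    graph x (tree w.*2) = i /\ graph x (tree w.*2.+1) = i.
  move=> i; have [/doubled_preimages[w wP]|ni] := pselect (doubled x i).
    by exists w.
  by exists 0%N.
rewrite [leRHS](sqnormID _ [set j | ~~ odd j /\ ~~ odd j./2]).
rewrite (_ : 2%:E = 1 + 1 :> \bar R)%E; last by rewrite -EFinD.
rewrite ge0_muleDl ?lee_fin// mul1e; apply: leeD.
  rewrite [X in (X <= _)%E](_ : _ =
      sqnorm (cutoff (doubled x) ((v \o graph x) \o (fun i => tree (w i).*2)))).
    apply: sqnorm_inj => [i j /set_mem/wP[wi _] /set_mem/wP[wj _] E|i _].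
      by rewrite -wi -wj E.
    have e : ~~ odd (tree (w i).*2) by rewrite odd_tree.
    by split; [left|split => //; rewrite /tree doubleK odd_double].
  congr sqnorm; apply/funext => i.
  have [Wi|nWi] := pselect (doubled x i); last by rewrite !cutoff_out.
  by rewrite !cutoff_in//= (wP i Wi).1.
rewrite [X in (X <= _)%E](_ : _ =
    sqnorm (cutoff (doubled x) ((v \o graph x) \o (fun i => tree (w i).*2.+1)))).
  apply: sqnorm_inj => [i j /set_mem/wP[_ wi] /set_mem/wP[_ wj] E|i _].
    by rewrite -wi -wj E.
  have e : ~~ odd (tree (w i).*2.+1) by rewrite odd_tree.
  split; first by left.
  by move=> [_]; rewrite /tree doubleK/= odd_double.
congr sqnorm; apply/funext => i.
have [Wi|nWi] := pselect (doubled x i); last by rewrite !cutoff_out.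
by rewrite !cutoff_in//= (wP i Wi).2.
Qed.

Definition remaining (j : nat) : nat :=
  if unlink j is Some (r, s, l) then r else 0%N.

(** Weighting Tv = lam v + residual by 5/4 and 5 and comparing with
    sqnorm_doubled gives 2 S <= (7/5) S + 5 S(residual) on the doubled part. *)
Lemma graph_doubled_bound x v (lam : C) : l2 v -> `|lam| ^+ 2 <= 28 / 25 ->
  (sqnorm (cutoff (doubled x) v) <=
   (10%:R)%:E * sqnorm (resid (graph x) lam v))%E.
Proof.
move=> vl lam1; have := sqnorm_doubled x v.
have /koopman_boundP[c c0 Fc] := graph_bounded x.
have rl := l2_resid lam Fc vl.
have Wl : l2 (cutoff (doubled x) v) := l2_cutoff _ vl.
have : (sqnorm (cutoff (doubled x) (v \o graph x)) <=
   (7 / 5)%:E * sqnorm (cutoff (doubled x) v) +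
   5%:E * sqnorm (resid (graph x) lam v))%E.
  apply: sqnorm_lin => // j.
  have [Wj|nWj] := pselect (doubled x j); last first.
    rewrite cutoff_out// normr0 expr0n addr_ge0 ?mulr_ge0 ?sqr_ge0 ?divr_ge0//.
  rewrite !cutoff_in//=.
  rewrite (_ : v (graph x j) = lam * v j + resid (graph x) lam v j); last first.
    by rewrite /resid addrCA subrr addr0.
  have t0 : 0 < 1 / 4 :> R by lra.
  apply: le_trans (sqr_normC_addw _ _ t0) _.
  rewrite div1r invrK (_ : 1 + 4 = 5 :> R); last by lra.
  rewrite lerD2r normCM exprMn mulrA ler_wpM2r ?sqr_ge0//; lra.
rewrite (l2E rl) (l2E Wl) => h1 /le_trans/(_ h1).
rewrite -!EFinM -EFinD !lee_fin.
have : 0 <= fine (sqnorm (resid (graph x) lam v)) by rewrite fine_ge0 ?sqnorm_ge0.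
lra.
Qed.

(** Going up a chain from its end, which is mapped into the doubled part, v at a
    link is controlled by v at its image, since lam is away from 0. The
    constant grows with the number m of steps. *)
Lemma graph_links_bound x (lam : C) m : 2 / 3 <= `|lam| ^+ 2 <= 28 / 25 ->
  exists2 K : R, 0 < K & forall v, l2 v ->
    (sqnorm (cutoff (doubled x `|` [set j | odd j /\ (remaining j < m)%N]) v) <=
     K%:E * sqnorm (resid (graph x) lam v))%E.
Proof.
move=> /andP[lam0 lam1]; have /koopman_boundP[c c0 Fc] := graph_bounded x.
elim: m => [|m [K K0 IH]].
  exists 10%:R => // v vl; apply: le_trans (graph_doubled_bound x vl lam1).
  by apply: sqnorm_cutoff_sub => j [//|[]].
exists (10 + 3 * K + 3) => [|v vl]; first by lra.
have rl := l2_resid lam Fc vl.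
set B := [set j | odd j /\ (remaining j < m.+1)%N].
have BK : (sqnorm (cutoff B (v \o graph x)) <= K%:E * sqnorm (resid (graph x) lam v))%E.
  apply: le_trans (IH v vl); apply: sqnorm_inj.
    move=> i j /set_mem[oi _] /set_mem[oj _]; apply: graph_inj.
    by rewrite /graph_class oi oj.
  move=> j [oj]; rewrite /remaining/= => jm.
  rewrite /graph oj; case uj : (unlink j) jm => [[[[|r] s] l]|] jm.
  - by left; left; rewrite /tree odd_double.
  - by right; split; [exact: odd_link|rewrite /remaining linkK].
  - by left; left; rewrite /tree odd_double.
have Bv : (sqnorm (cutoff B v) <= 3%:E * sqnorm (cutoff B (v \o graph x)) +
    3%:E * sqnorm (resid (graph x) lam v))%E.
  apply: sqnorm_lin => // j.
  have [Bj|nBj] := pselect (B j); last first.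
    by rewrite !cutoff_out// normr0 expr0n mulr0 add0r mulr_ge0// sqr_ge0.
  rewrite !cutoff_in//=.
  have := sqr_normC_add (v (graph x j)) (- resid (graph x) lam v j).
  rewrite (_ : v (graph x j) + - resid (graph x) lam v j = lam * v j); last first.
    by rewrite /resid opprB addrC subrK.
  rewrite normrN normCM exprMn.
  have := sqr_ge0 `|v j|; move: (`|v j| ^+ 2) (`|lam| ^+ 2) lam0 => a b; nra.
have WB : (sqnorm (cutoff (doubled x `|` B) v) <=
    sqnorm (cutoff (doubled x) v) + sqnorm (cutoff B v))%E.
  rewrite -[sqnorm (cutoff (doubled x) v)]mul1e -[sqnorm (cutoff B v)]mul1e.
  apply: sqnorm_lin => // j; rewrite !mul1r.
  have [Wj|nWj] := pselect (doubled x j).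
    by rewrite [cutoff _ v j]cutoff_in; [rewrite (cutoff_in _ Wj) lerDl sqr_ge0|left].
  have [Bj|nBj] := pselect (B j).
    by rewrite [cutoff _ v j]cutoff_in; [rewrite (cutoff_in _ Bj) lerDr sqr_ge0|right].
  by rewrite cutoff_out ?normr0 ?expr0n ?addr_ge0 ?sqr_ge0// => -[].
apply: le_trans WB _; move: Bv BK (graph_doubled_bound x vl lam1).
have Wl : l2 (cutoff (doubled x) v) := l2_cutoff _ vl.
have Bl : l2 (cutoff B v) := l2_cutoff _ vl.
have BFl : l2 (cutoff B (v \o graph x)) := l2_cutoff _ (l2_le (Fc v vl) vl).
rewrite (l2E rl) (l2E Wl) (l2E Bl) (l2E BFl) -!EFinM -!EFinD !lee_fin.
by move: (fine _) (fine _) (fine _) (fine _) => p q r s; nra.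
Qed.

(** If x n <= k for infinitely many n, then every link with r + l >= k belongs to
    a chain that is hit, and the other links have r <= k; so the bound on
    chains of bounded length covers all vertices. *)
Lemma graph_gap x (lam : C) : ~ tends_to_infty x ->
  Sp_ap (koopman (R := R) (graph x)) lam -> 1 / 20 < `|1 - lam : C|.
Proof.
move=> nx Sl; rewrite ltNge; apply/negP => lam1.
have [k kP] : exists k, forall s, exists n, (s <= n)%N && (x n <= k)%N.
  apply: contrapT => H; apply: nx => k; apply: contrapT => nk.
  apply: H; exists k => s; apply: contrapT => ns; apply: nk.
  exists s => n sn; rewrite leqNgt; apply/negP => xn; apply: ns.
  by exists n; rewrite sn ltnW.
have hits s k' : (k <= k')%N -> exists n, first_hit x k' s n.
  move=> kk'; have : exists n, (s <= n)%N && (x n <= k')%N.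
    by have [n /andP[sn xn]] := kP s; exists n; rewrite sn (leq_trans xn).
  move=> /ex_minnP[n /andP[sn xn] nmin]; exists n; apply/and3P; split => //.
  apply/forallP => i; apply/implyP => si; rewrite ltnNge; apply/negP => xi.
  by have := nmin i; rewrite si xi => /(_ isT); rewrite leqNgt ltn_ord.
have all_covered : doubled x `|` [set j | odd j /\ (remaining j < k.+1)%N] = setT.
  apply/seteqP; split => // j _.
  have [oj|ej] := boolP (odd j); last by left; left.
  case uj : (unlink j) => [[[r s] l]|]; last by right; rewrite /= /remaining uj.
  have [rk|kr] := leqP r k; first by right; rewrite /= /remaining uj ltnS.
  left; right; exists (r, s, l); first exact: unlinkK.
  by apply: hits; rewrite /= (leq_trans (ltnW kr))// leq_addr.
have lamb : 2 / 3 <= `|lam| ^+ 2 <= 28 / 25.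
  have h1 : `|lam| <= 21 / 20.
    rewrite -[lam](subrK 1) (le_trans (ler_normD _ _))// distrC normC1; lra.
  have h2 : 19 / 20 <= `|lam|.
    have : `|1 : C| <= `|1 - lam : C| + `|lam|.
      by rewrite -[X in `|X| <= _](subrK lam) ler_normD.
    rewrite normC1; lra.
  by apply/andP; split; nra.
have [K K0 KP] := graph_links_bound x k.+1 lamb.
have KV : 0 < (2 * K)^-1 by rewrite invr_gt0 mulr_gt0.
have [v [vl v0 vr]] := (Sp_apP lam (graph_bounded x)).1 Sl _ KV.
have := KP v vl; rewrite all_covered cutoff_setT => vK.
have : (sqnorm v <= (1 / 2)%:E * sqnorm v)%E.
  apply: le_trans vK _; apply: (@le_trans _ _ (K%:E * ((2 * K)^-1%:E * sqnorm v))%E).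
    by rewrite lee_wpmul2l// lee_fin ltW.
  by rewrite muleA -EFinM invfM mulrCA divff ?gt_eqF// mulr1 div1r.
move: v0; rewrite (l2E vl) -EFinM lee_fin lte_fin; lra.
Qed.

End GraphSpectrum.

(** * No tower of height two *)

Section LowerBound.
Variable R : realType.
Local Notation C := (Rcomplex R).

Lemma dist_to_mdist (z : C) (A B : compacts R) :
  dist_to z B <= dist_to z A + mdist A B.
Proof.
apply/ler_addgt0Pr => e e0; have [a Aa za] := dist_to_lt z A e0.
apply: le_trans (dist_to_lip z a B) _.
have : dist_to a B <= mdist A B.
  by apply: le_trans (dist_to_excess B Aa) _; rewrite le_max lexx.
lra.
Qed.

Lemma cvg_dist_to (z : C) (A_ : nat -> compacts R) (A : compacts R) (e : R) :
  A_ n @[n --> \oo] --> A -> 0 < e ->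
  exists N, forall n, (N <= n)%N ->
    dist_to z (A_ n) < dist_to z A + e /\ dist_to z A < dist_to z (A_ n) + e.
Proof.
move=> /cvg_ballP/(_ e) H e0; have [N _ NP] := H e0.
exists N => n /NP /=; rewrite ballEmdist/= => An.
have h1 := dist_to_mdist z A (A_ n); have h2 := dist_to_mdist z (A_ n) A.
by rewrite metric_sym in h2; split; lra.
Qed.

Lemma finite_bound (T : Type) (L : set T) (N : T -> nat) : finite_set L ->
  exists n, forall f, L f -> (N f <= n)%N.
Proof.
move=> Lfin; have : finite_set (N @` L) by exact: finite_image.
move=> /finite_fsetP[X XE]; exists (\max_(i <- finmap.enum_fset X) i)%N => f Lf.
have : (N @` L) (N f) by exists f.
by rewrite XE/= => NX; apply: leq_bigmax_seq.
Qed.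

Variables (Xi : OmegaN R -> compacts R).
Hypothesis XiE : forall F : OmegaN R, cset (Xi F) = Sp_ap (koopman (sval F)).

Lemma general_algorithm_prefix_open (Gam : OmegaN R -> compacts R) (P : set (compacts R)) :
  general_algorithm (problemN Xi) Gam ->
  prefix_open [set x | P (Gam (graphN R x))].
Proof.
move=> [L LP] x /= Px; have [Lsub _ Lfin Lcons] := LP (graphN R x).
have /choice[N NP] : forall f : OmegaN R -> nat, exists N, L (graphN R x) f ->
    forall y, (forall n, (n < N)%N -> y n = x n) -> f (graphN R x) = f (graphN R y).
  move=> f; have [Lf|nLf] := pselect (L (graphN R x) f); last by exists 0%N.
  have [j _ <-] := Lsub _ Lf; have [N NP] := graph_continuous x j.
  by exists N => _ y /NP; rewrite /evalN/=.
have [n nP] := finite_bound N Lfin; exists n => y yx.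
have [f Lf|_ ->//] := Lcons (graphN R y).
by apply: NP => // i iN; apply: yx; rewrite (leq_trans iN)// nP.
Qed.

(** Given such limits, x tends to infinity iff from some m on the distance of 1
    to Gam m n is less than 1/40 for infinitely many n. Each of these
    inequalities depends on a finite prefix of x, so this contradicts
    tends_to_infty_not_Gdelta_sigma. *)
Lemma no_two_limits (Gam : nat -> nat -> OmegaN R -> compacts R)
    (Gam1 : nat -> OmegaN R -> compacts R) :
  (forall m n, general_algorithm (problemN Xi) (Gam m n)) ->
  (forall m A, Gam m n A @[n --> \oo] --> Gam1 m A) ->
  (forall A, Gam1 m A @[m --> \oo] --> Xi A) -> False.
Proof.
move=> Galg G1 GXi.
(* The index t codes a pair (m, k). *)
pose O M t : set (nat -> nat) :=
  if (unpickle t : option (nat * nat)) is Some (m, k) then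
    [set x | (M <= m)%N -> exists2 n, (k <= n)%N &
      dist_to 1 (Gam m n (graphN R x)) < 1 / 40]
  else setT.
apply: (@tends_to_infty_not_Gdelta_sigma O).
  move=> M t; rewrite /O; case: unpickle => [[m k]|]; last by move=> x _; exists 0%N.
  have [Mm|_] := boolP (M <= m)%N; last by move=> x _; exists 0%N.
  move=> x /= /(_ isT)[n kn xn].
  have [N NP] := @general_algorithm_prefix_open _ [set A | dist_to 1 A < 1 / 40] (Galg m n) x xn.
  by exists N => y /NP yn _; exists n.
move=> x; pose A := graphN R x; split.
  move=> /graph_Sp_ap1 => /(_ R) x1.
  have d0 : dist_to 1 (Xi A) <= 0.
    rewrite -(normr0 C) -(subrr (1 : C)); apply: dist_to_le.
    by rewrite XiE.
  have e0 : 0 < 1 / 80 :> R by lra.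
  have [M MP] := cvg_dist_to 1 (GXi A) e0; exists M => t.
  rewrite /O; case: unpickle => [[m k]|//] /= Mm.
  have [N NP] := cvg_dist_to 1 (G1 m A) e0.
  exists (maxn k N); first exact: leq_maxl.
  have [h1 _] := MP _ Mm; have [h2 _] := NP _ (leq_maxr k N).
  by rewrite -/A; lra.
move=> [M MP]; apply: contrapT => nx.
have gap : 1 / 20 <= dist_to 1 (Xi A).
  apply: lb_le_inf; first by have [a Aa] := cset_nonempty (Xi A); exists `|1 - a : C|, a.
  by move=> _ [a Xa <-]; apply/ltW/(graph_gap nx); rewrite XiE in Xa.
have e0 : 0 < 1 / 160 :> R by lra.
have [N NP] := cvg_dist_to 1 (GXi A) e0.
have [_ h1] := NP _ (leq_maxr M N).
have [k kP] := cvg_dist_to 1 (G1 (maxn M N) A) e0.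
have := MP (pickle (maxn M N, k)); rewrite /O pickleK/= leq_maxl => /(_ isT)[n kn].
by have [_ h2] := kP n kn; rewrite -/A; lra.
Qed.

Lemma not_Delta3G : ~ Delta3G (problemN Xi).
Proof.
move=> [[//|[|[|//]]] _ [G [G0 Glim Galg]]].
  (* Height one is height two with a constant inner sequence. *)
  apply: (@no_two_limits (fun m _ => G [:: m]) (fun m => G [:: m])) => [m _|m A|A].
  - exact: Galg.
  - exact: cvg_cst.
  - by have := Glim [::] A isT; rewrite G0.
apply: (@no_two_limits (fun m n => G [:: m; n]) (fun m => G [:: m])) => [m n|m A|A].
- exact: Galg.
- exact: (Glim [:: m] A isT).
- by have := Glim [::] A isT; rewrite G0.
Qed.

End LowerBound.

(** * Closure properties of total recursive functions with an oracle *)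

Section Computable.
Local Open Scope nat_scope.
Implicit Types (n : nat) (o : nat -> nat) (xs ys : seq nat).

Definition operation := (nat -> nat) -> seq nat -> nat.
Implicit Types (f g h k : operation).

(** Correctness is required for inputs of a fixed length n: such an input can be
    rebuilt from finitely many projections, as composition requires. *)
Definition computable n f : Prop :=
  exists p, forall o xs, size xs = n -> oeval o p xs (f o xs).

Lemma computable_ext n f g : (forall o xs, size xs = n -> f o xs = g o xs) ->
  computable n f -> computable n g.
Proof. by move=> fg [p pf]; exists p => o xs sx; rewrite -fg//; exact: pf. Qed.

Fixpoint all_computable n (gs : seq operation) : Prop :=
  if gs is g :: gs' then computable n g /\ all_computable n gs' else True.

Lemma computable_comp n f (gs : seq operation) :
  computable (size gs) f -> all_computable n gs ->
  computable n (fun o xs => f o [seq g o xs | g <- gs]).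
Proof.
move=> [p pf] gsP.
have [ps psP] : exists ps, forall o xs, size xs = n ->
    (fix oevals (gs : seq oprog) (ys : seq nat) : Prop :=
         match gs, ys with
         | [::], [::] => True
         | g :: gs', y' :: ys' => oeval o g xs y' /\ oevals gs' ys'
         | _, _ => False
         end) ps [seq g o xs | g <- gs].
  elim: gs gsP {pf} => [_|g gs IH [[q qg] /IH[ps psP]]]; first by exists [::].
  by exists (q :: ps) => o xs sx /=; split; [exact: qg|exact: psP].
exists (OComp p ps) => o xs sx; exists [seq g o xs | g <- gs].
  exact: psP.
by apply: pf; rewrite size_map.
Qed.

Lemma computable_proj n i : computable n (fun o xs => nth 0 xs i).
Proof. by exists (OProj i). Qed.

Lemma computable_proj_range n m l : all_computable n
  [seq (fun o xs => nth 0 xs i) : operation | i <- iota m l].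
Proof. by elim: l m => //= l IH m; split; [exact: computable_proj|exact: IH]. Qed.

(** In the body of a loop the outer arguments come after the loop variables. *)
Lemma computable_weak n f : computable n f ->
  computable n.+1 (fun o xs => f o (behead xs)).
Proof.
move=> nf.
pose gs := [seq (fun o xs => nth 0 xs i) : operation | i <- iota 1 n].
have : computable n.+1 (fun o xs => f o [seq g o xs | g <- gs]).
  apply: computable_comp; last exact: computable_proj_range.
  by rewrite size_map size_iota.
apply: computable_ext => o [|x xs] //= [sx]; congr (f o _).
rewrite -map_comp; apply: (@eq_from_nth _ 0) => [|i].
  by rewrite size_map size_iota sx.
by rewrite size_map size_iota => i_n; rewrite (nth_map 0) ?size_iota// nth_iota.
Qed.

Lemma computable_weak2 n f : computable n f ->
  computable n.+2 (fun o xs => f o (behead (behead xs))).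
Proof. by move=> /computable_weak/computable_weak. Qed.

Lemma computable_skip n f : computable n.+1 f ->
  computable n.+2 (fun o xs => f o (nth 0 xs 0 :: behead (behead xs))).
Proof.
move=> nf.
pose gs := [seq (fun o xs => nth 0 xs i) : operation | i <- 0 :: iota 2 n].
have : computable n.+2 (fun o xs => f o [seq g o xs | g <- gs]).
  apply: computable_comp; first by rewrite size_map/= size_iota.
  by split; [exact: computable_proj|exact: computable_proj_range].
apply: computable_ext => o [|x [|y xs]] //= [sx]; congr (f o (_ :: _)).
rewrite -map_comp; apply: (@eq_from_nth _ 0) => [|i].
  by rewrite size_map size_iota sx.
by rewrite size_map size_iota => i_n; rewrite (nth_map 0) ?size_iota// nth_iota.
Qed.

(** The body receives the counter, then the accumulator, then the outer
    arguments. *)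
Lemma computable_iteri n k f (h : (nat -> nat) -> seq nat -> nat -> nat -> nat) :
  computable n k -> computable n f ->
  computable n.+2 (fun o ys => h o (behead (behead ys)) (nth 0 ys 0) (nth 0 ys 1)) ->
  computable n (fun o xs => iteri (k o xs) (h o xs) (f o xs)).
Proof.
move=> nk [pf fP] [ph hP].
have rec_n : computable n.+1
    (fun o xs => iteri (nth 0 xs 0) (h o (behead xs)) (f o (behead xs))).
  exists (ORec pf ph) => o [|m xs] //= [sx].
  exists (fun i => iteri i (h o xs) (f o xs)); split => // [|i im].
    exact: fP.
  by have := hP o [:: i, iteri i (h o xs) (f o xs) & xs]; rewrite /= sx; apply.
pose gs := k :: [seq (fun o xs => nth 0 xs i) : operation | i <- iota 0 n].
have := @computable_comp n _ gs.
rewrite /= size_map size_iota => /(_ _ rec_n)/(_ (conj nk (computable_proj_range _ _ _))).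
apply: computable_ext => o xs sx /=; rewrite -map_comp.
have -> // : [seq ((fun g : operation => g o xs) \o
  (fun i : nat => (fun _ xs => nth 0 xs i) : operation)) i | i <- iota 0 n] = xs.
apply: (@eq_from_nth _ 0) => [|i]; first by rewrite size_map size_iota sx.
by rewrite size_map size_iota => i_n; rewrite (nth_map 0) ?size_iota// nth_iota.
Qed.

Lemma computable_oracle n f : computable n f -> computable n (fun o xs => o (f o xs)).
Proof.
move=> nf; apply: (@computable_comp n (fun o ys => o (nth 0 ys 0)) [:: f]) => //.
by exists OOracle.
Qed.

Lemma computable_succ n f : computable n f -> computable n (fun o xs => (f o xs).+1).
Proof.
move=> nf; apply: (@computable_comp n (fun o ys => (nth 0 ys 0).+1) [:: f]) => //.
by exists OSucc.
Qed.

Lemma computable_const n c : computable n (fun _ _ => c).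
Proof. by elim: c => [|c IH]; [exists OZero|exact: computable_succ]. Qed.

Lemma computable_add n f g : computable n f -> computable n g ->
  computable n (fun o xs => f o xs + g o xs).
Proof.
move=> nf ng.
apply: (@computable_ext n (fun o xs => iteri (g o xs) (fun _ r => r.+1) (f o xs))).
  by move=> o xs _; elim: (g o xs) => [|m /= ->]; rewrite ?addn0 ?addnS.
apply: computable_iteri => //; apply: computable_succ; exact: computable_proj.
Qed.

Lemma computable_mul n f g : computable n f -> computable n g ->
  computable n (fun o xs => f o xs * g o xs).
Proof.
move=> nf ng.
apply: (@computable_ext n (fun o xs => iteri (g o xs) (fun _ r => r + f o xs) 0)).
  by move=> o xs _; elim: (g o xs) => [|m /= ->]; rewrite ?muln0 ?mulnS// addnC.
apply: (@computable_iteri _ _ (fun _ _ => 0) (fun o xs _ r => r + f o xs)) => //.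
  exact: computable_const.
by apply: computable_add; [exact: computable_proj|exact: computable_weak2].
Qed.

Lemma computable_pred n f : computable n f -> computable n (fun o xs => (f o xs).-1).
Proof.
move=> nf.
apply: (@computable_ext n (fun o xs => iteri (f o xs) (fun i _ => i) 0)).
  by move=> o xs _; case: (f o xs).
apply: (@computable_iteri _ _ (fun _ _ => 0) (fun _ _ i _ => i)) => //.
  exact: computable_const.
exact: computable_proj.
Qed.

Lemma computable_sub n f g : computable n f -> computable n g ->
  computable n (fun o xs => f o xs - g o xs).
Proof.
move=> nf ng.
apply: (@computable_ext n (fun o xs => iteri (g o xs) (fun _ r => r.-1) (f o xs))).
  by move=> o xs _; elim: (g o xs) => [|m /= ->]; rewrite ?subn0 ?subnS.
apply: computable_iteri => //; apply: computable_pred; exact: computable_proj.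
Qed.

Lemma computable_exp n f g : computable n f -> computable n g ->
  computable n (fun o xs => f o xs ^ g o xs).
Proof.
move=> nf ng.
apply: (@computable_ext n (fun o xs => iteri (g o xs) (fun _ r => r * f o xs) 1)).
  by move=> o xs _; elim: (g o xs) => [|m /= ->]; rewrite ?expn0// expnS mulnC.
apply: (@computable_iteri _ _ (fun _ _ => 1) (fun o xs _ r => r * f o xs)) => //.
  exact: computable_const.
by apply: computable_mul; [exact: computable_proj|exact: computable_weak2].
Qed.

Lemma computable_ltn n f g : computable n f -> computable n g ->
  computable n (fun o xs => (f o xs < g o xs) : nat).
Proof.
move=> nf ng.
apply: (@computable_ext n (fun o xs => 1 - ((f o xs).+1 - g o xs))).
  by move=> o xs _; case: ltnP; lia.
by apply: computable_sub (computable_const _ _) _; apply: computable_sub => //; exact: computable_succ.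
Qed.

Lemma computable_if n (b : (nat -> nat) -> seq nat -> bool) f g :
  computable n (fun o xs => b o xs : nat) ->
  computable n f -> computable n g ->
  computable n (fun o xs => if b o xs then f o xs else g o xs).
Proof.
move=> nb nf ng.
apply: (@computable_ext n (fun o xs => (b o xs) * f o xs + (1 - b o xs) * g o xs)).
  by move=> o xs _; case: (b o xs); rewrite ?mul1n ?mul0n ?addn0.
apply: computable_add; apply: computable_mul => //.
by apply: computable_sub => //; exact: computable_const.
Qed.

Lemma computable_sum n k (h : (nat -> nat) -> seq nat -> nat -> nat) :
  computable n k ->
  computable n.+1 (fun o ys => h o (behead ys) (nth 0 ys 0)) ->
  computable n (fun o xs => \sum_(i < k o xs) h o xs i).
Proof.
move=> nk nh.
apply: (@computable_ext n (fun o xs => iteri (k o xs) (fun i r => r + h o xs i) 0)).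
  move=> o xs _; elim: (k o xs) => [|m IH]; first by rewrite big_ord0.
  by rewrite big_ord_recr/= -IH.
apply: (@computable_iteri _ _ (fun _ _ => 0) (fun o xs i r => r + h o xs i)) => //.
  exact: computable_const.
by apply: computable_add; [exact: computable_proj|exact: (computable_skip nh)].
Qed.

Lemma computable_div n f g : computable n f -> computable n g ->
  computable n (fun o xs => f o xs %/ (g o xs).+1).
Proof.
move=> nf ng.
apply: (@computable_ext n (fun o xs =>
    \sum_(i < f o xs) (i.+1 * (g o xs).+1 < (f o xs).+1 : nat))).
  move=> o xs _; move: (f o xs) (g o xs) => a d.
  rewrite (eq_bigr (fun i : 'I_a => (i < a %/ d.+1 : nat))) => [|i _].
    have count b q : \sum_(i < b) (i < q : nat) = minn b q.
      elim: b => [|b IH]; first by rewrite big_ord0 min0n.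
      by rewrite big_ord_recr/= IH; lia.
    by rewrite count; apply/minn_idPr/leq_div.
  by rewrite ltnS -leq_divRL.
apply: (@computable_sum n f (fun o xs i => (i.+1 * (g o xs).+1 < (f o xs).+1 : nat))) => //.
apply: computable_ltn; last exact/computable_succ/computable_weak.
apply: computable_mul; last exact/computable_succ/computable_weak.
exact/computable_succ/computable_proj.
Qed.

Lemma computable_mod n f g : computable n f -> computable n g ->
  computable n (fun o xs => f o xs %% (g o xs).+1).
Proof.
move=> nf ng.
apply: (@computable_ext n (fun o xs => f o xs - f o xs %/ (g o xs).+1 * (g o xs).+1)).
  by move=> o xs _; rewrite {1}(divn_eq (f o xs) (g o xs).+1) addnC addnK.
apply: computable_sub => //; apply: computable_mul; last exact: computable_succ.
exact: computable_div.
Qed.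

End Computable.

(** * The grid algorithm on natural numbers *)

Section Algorithm.
Local Open Scope nat_scope.
Implicit Types (o : nat -> nat).

(** The base is b + 2, so that all pairs (p, b) code a finitely supported
    sequence of naturals. *)
Definition digit p b j := p %/ b.+2 ^ j %% b.+2.

(** Entry j of a Gaussian integer vector occupies four digits: positive and
    negative part of its real part, then of its imaginary part. *)
Definition coord p b j e := digit p b (4 * j + e).

(** Subtraction is truncated, so one of the two terms vanishes. *)
Definition sqdist m n := (m - n) ^ 2 + (n - m) ^ 2.

(** M^2 |v (o j) - z v j|^2 at the grid point z = ((a - W) + (c - W) i) / M, with
    the positive and negative terms kept apart; see resid_termE. *)
Definition resid_term o M W a c p b j :=
  sqdist
    (M * coord p b (o j) 0 + a * coord p b j 1 + W * coord p b j 0 +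
      c * coord p b j 2 + W * coord p b j 3)
    (M * coord p b (o j) 1 + a * coord p b j 0 + W * coord p b j 1 +
      c * coord p b j 3 + W * coord p b j 2) +
  sqdist
    (M * coord p b (o j) 2 + a * coord p b j 3 + W * coord p b j 2 +
      c * coord p b j 1 + W * coord p b j 0)
    (M * coord p b (o j) 3 + a * coord p b j 2 + W * coord p b j 3 +
      c * coord p b j 0 + W * coord p b j 1).

Definition norm_term p b j :=
  sqdist (coord p b j 0) (coord p b j 1) + sqdist (coord p b j 2) (coord p b j 3).

Definition witness o M W n a c p b :=
  \sum_(j < n.+1) resid_term o M W a c p b j <
  16 * \sum_(j < p.+1) norm_term p b j.

Definition witness_count o M W n a c p := \sum_(b < W.+1) witness o M W n a c p b.

Definition accepts o M W n a c := 0 < \sum_(p < W.+1) witness_count o M W n a c p.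

Definition cons_code m n := 2 ^ m * (n + n).+1.

Definition block_code W M a c acc := cons_code a (cons_code W (cons_code c
  (cons_code W (cons_code M.-1 acc)))).

(** The loop runs over the pairs (a, c), listed as a (2 W + 1) + c. *)
Definition grid_code o M W n := iteri ((W + W).+1 * (W + W).+1)
  (fun t acc => if accepts o M W n (t %/ (W + W).+1) (t %% (W + W).+1)
     then block_code W M (t %/ (W + W).+1) (t %% (W + W).+1) acc else acc) 0.

(** Outputs are nonempty sets, so 0 is returned when nothing is accepted. *)
Definition output_code o M W n :=
  if 0 < grid_code o M W n then grid_code o M W n else block_code 0 1 0 0 0.

Section Computability.
Variable l : nat.
Implicit Types f : operation.
Local Notation comp f := (computable l f).

Lemma computable_digit p b j : comp p -> comp b -> comp j ->
  comp (fun o xs => digit (p o xs) (b o xs) (j o xs)).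
Proof.
move=> cp cb cj; apply: (@computable_ext _ (fun o xs =>
   (p o xs %/ ((b o xs).+2 ^ j o xs).-1.+1) %% (b o xs).+2)).
  by move=> o xs _; rewrite prednK ?expn_gt0.
apply: (computable_mod (f := fun o xs => _)); last exact: computable_succ.
apply: computable_div => //; apply/computable_pred/computable_exp => //.
exact/computable_succ/computable_succ.
Qed.

Lemma computable_coord p b j e : comp p -> comp b -> comp j ->
  comp (fun o xs => coord (p o xs) (b o xs) (j o xs) e).
Proof.
move=> cp cb cj; apply: (computable_digit (j := fun o xs => 4 * j o xs + e)) => //.
by apply/computable_add/computable_const/computable_mul => //; exact: computable_const.
Qed.

Lemma computable_sqdist f g : comp f -> comp g ->
  comp (fun o xs => sqdist (f o xs) (g o xs)).
Proof.
move=> cf cg.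
by apply: computable_add; apply: computable_exp;
  try exact: computable_const; exact: computable_sub.
Qed.

Lemma computable_resid_term M W a c p b j :
  comp M -> comp W -> comp a -> comp c -> comp p -> comp b -> comp j ->
  comp (fun o xs => resid_term o (M o xs) (W o xs) (a o xs) (c o xs) (p o xs) (b o xs) (j o xs)).
Proof.
move=> cM cW ca cc cp cb cj; rewrite /resid_term.
by apply: computable_add; apply: computable_sqdist;
  do ![apply: computable_add]; apply: computable_mul => //;
  apply: computable_coord => //; exact: computable_oracle.
Qed.

Lemma computable_norm_term p b j : comp p -> comp b -> comp j ->
  comp (fun o xs => norm_term (p o xs) (b o xs) (j o xs)).
Proof.
move=> cp cb cj.
by apply: computable_add; apply: computable_sqdist; exact: computable_coord.
Qed.

End Computability.

Lemma computable_witness l M W n a c p b :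
  computable l M -> computable l W -> computable l n -> computable l a ->
  computable l c -> computable l p -> computable l b ->
  computable l (fun o xs => witness o (M o xs) (W o xs) (n o xs) (a o xs)
    (c o xs) (p o xs) (b o xs) : nat).
Proof.
move=> cM cW cn ca cc cp cb; apply: computable_ltn.
  apply: (@computable_sum l (fun o xs => (n o xs).+1) (fun o xs j =>
    resid_term o (M o xs) (W o xs) (a o xs) (c o xs) (p o xs) (b o xs) j)).
    exact: computable_succ.
  by apply: computable_resid_term;
    try exact: computable_weak; exact: computable_proj.
apply: computable_mul; first exact: computable_const.
apply: (@computable_sum l (fun o xs => (p o xs).+1) (fun o xs j =>
    norm_term (p o xs) (b o xs) j)); first exact: computable_succ.
by apply: computable_norm_term; try exact: computable_weak; exact: computable_proj.
Qed.

Lemma computable_witness_count l M W n a c p :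
  computable l M -> computable l W -> computable l n -> computable l a ->
  computable l c -> computable l p ->
  computable l (fun o xs => witness_count o (M o xs) (W o xs) (n o xs) (a o xs)
    (c o xs) (p o xs)).
Proof.
move=> cM cW cn ca cc cp.
apply: (@computable_sum l (fun o xs => (W o xs).+1) (fun o xs b =>
  witness o (M o xs) (W o xs) (n o xs) (a o xs) (c o xs) (p o xs) b)).
  exact: computable_succ.
by apply: computable_witness; try exact: computable_weak; exact: computable_proj.
Qed.

Lemma computable_accepts l M W n a c :
  computable l M -> computable l W -> computable l n -> computable l a ->
  computable l c ->
  computable l (fun o xs => accepts o (M o xs) (W o xs) (n o xs) (a o xs) (c o xs) : nat).
Proof.
move=> cM cW cn ca cc; apply: computable_ltn; first exact: computable_const.
apply: (@computable_sum l (fun o xs => (W o xs).+1) (fun o xs p =>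
  witness_count o (M o xs) (W o xs) (n o xs) (a o xs) (c o xs) p)).
  exact: computable_succ.
by apply: computable_witness_count; try exact: computable_weak; exact: computable_proj.
Qed.

Lemma computable_cons_code l f g : computable l f -> computable l g ->
  computable l (fun o xs => cons_code (f o xs) (g o xs)).
Proof.
move=> cf cg; apply: computable_mul; last exact/computable_succ/computable_add.
by apply: computable_exp => //; exact: computable_const.
Qed.

Lemma computable_block_code l M W a c acc :
  computable l M -> computable l W -> computable l a -> computable l c ->
  computable l acc ->
  computable l (fun o xs => block_code (W o xs) (M o xs) (a o xs) (c o xs) (acc o xs)).
Proof.
move=> cM cW ca cc cacc; do 4![apply: computable_cons_code => //].
by apply: computable_cons_code => //; exact: computable_pred.
Qed.

Lemma computable_grid_code l M W n :
  computable l M -> computable l W -> computable l n ->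
  computable l (fun o xs => grid_code o (M o xs) (W o xs) (n o xs)).
Proof.
move=> cM cW cn.
have cWW : computable l (fun o xs => W o xs + W o xs) by exact: computable_add.
apply: (@computable_iteri l _ (fun _ _ => 0) (fun o xs t acc =>
  if accepts o (M o xs) (W o xs) (n o xs) (t %/ (W o xs + W o xs).+1)
    (t %% (W o xs + W o xs).+1)
  then block_code (W o xs) (M o xs) (t %/ (W o xs + W o xs).+1)
    (t %% (W o xs + W o xs).+1) acc else acc)).
- by apply: computable_mul; exact: computable_succ.
- exact: computable_const.
have cM2 := computable_weak2 cM; have cW2 := computable_weak2 cW.
have cn2 := computable_weak2 cn; have cWW2 := computable_weak2 cWW.
have c0 := computable_proj l.+2 0; have c1 := computable_proj l.+2 1.
have cd := computable_div c0 cWW2; have cm := computable_mod c0 cWW2.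
apply: computable_if => //.
  exact: (computable_accepts cM2 cW2 cn2 cd cm).
exact: (computable_block_code cM2 cW2 cd cm c1).
Qed.

Lemma computable_output_code l M W n :
  computable l M -> computable l W -> computable l n ->
  computable l (fun o xs => output_code o (M o xs) (W o xs) (n o xs)).
Proof.
move=> cM cW cn; have cg := computable_grid_code cM cW cn.
apply: computable_if => //; last exact: computable_const.
by apply: computable_ltn => //; exact: computable_const.
Qed.

Lemma output_program : exists p : oprog, forall o (m W n : nat),
  oeval o p [:: m; W; n] (output_code o (2 ^ m.+2) W n).
Proof.
have [|p pP] := @computable_output_code 3 (fun _ xs => 2 ^ (nth 0 xs 0).+2)
    (fun _ xs => nth 0 xs 1) (fun _ xs => nth 0 xs 2) _
    (computable_proj _ _) (computable_proj _ _).
  apply: computable_exp; first exact: computable_const.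
  exact/computable_succ/computable_succ/computable_proj.
by exists p => o m W n; exact: (pP o [:: m; W; n]).
Qed.

End Algorithm.

(** * Gaussian integer vectors as test vectors *)

Lemma digit_expansion (b n : nat) (d : nat -> nat) i :
  (forall k, (d k < b.+2)%N) ->
  digit (\sum_(k < n) d k * b.+2 ^ k)%N b i = if (i < n)%N then d i else 0%N.
Proof.
move=> db; elim: n d db i => [|n IH] d db i.
  by rewrite big_ord0 /digit div0n mod0n.
rewrite big_ord_recl/= expn0 muln1.
have -> : (\sum_(k < n) d (bump 0 k) * b.+2 ^ bump 0 k =
    (\sum_(k < n) d k.+1 * b.+2 ^ k) * b.+2)%N.
  by rewrite big_distrl/=; apply: eq_bigr => k _; rewrite -mulnA -expnSr.
case: i => [|i].
  by rewrite /digit expn0 divn1 addnC modnMDl modn_small.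
rewrite /digit expnS divnMA addnC divnMDl// (divn_small (db 0%N)) addn0.
exact: (IH (fun k => d k.+1)).
Qed.

Lemma digit_big p b i : (p < i)%N -> digit p b i = 0%N.
Proof.
move=> pi; rewrite /digit divn_small ?mod0n// (ltn_trans pi)//.
by rewrite (leq_trans (ltn_expl i (isT : (1 < 2)%N)))// leq_exp2r// (leq_ltn_trans _ pi).
Qed.

Section Semantics.
Variable R : realType.
Local Notation C := (Rcomplex R).
Implicit Types (F : nat -> nat) (z lam : C).

Definition gaussian_vec (p b : nat) : nat -> C := fun j =>
  Complex ((coord p b j 0)%:R - (coord p b j 1)%:R)
          ((coord p b j 2)%:R - (coord p b j 3)%:R).

Definition grid_point (M W a c : nat) : C :=
  Complex ((a%:R - W%:R) / M%:R) ((c%:R - W%:R) / M%:R).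

Lemma gaussian_vec_supp p b j : (p < j)%N -> gaussian_vec p b j = 0.
Proof.
move=> pj; have pj4 e : (p < 4 * j + e)%N by lia.
by rewrite /gaussian_vec /coord !digit_big// subrr.
Qed.

Lemma sqdistE m n : (sqdist m n)%:R = (m%:R - n%:R) ^+ 2 :> R.
Proof.
rewrite /sqdist natrD !natrX; have [mn|/ltnW nm] := leqP m n.
  by rewrite (eqP mn) natrB// expr0n add0r -sqrrN opprB.
by rewrite (eqP nm) natrB// expr0n addr0.
Qed.

Lemma norm_termE p b j : (norm_term p b j)%:R = `|gaussian_vec p b j| ^+ 2 :> R.
Proof. by rewrite /norm_term natrD !sqdistE sqr_normC. Qed.

Lemma sqnorm_gaussian_vec p b :
  sqnorm (gaussian_vec p b) = ((\sum_(j < p.+1) norm_term p b j)%N%:R)%:E :> \bar R.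
Proof.
rewrite (@sqnorm_finsupp _ _ p.+1); last by move=> j; exact: gaussian_vec_supp.
by rewrite natr_sum; congr EFin; apply: eq_bigr => j _; rewrite norm_termE.
Qed.

Lemma ComplexM (a b a' b' : R) : Complex a b * Complex a' b' =
  Complex (a * a' - b * b') (a * b' + b * a') :> C.
Proof. by []. Qed.

Lemma resid_termE F M W a c p b j : (0 < M)%N ->
  (resid_term F M W a c p b j)%:R =
  M%:R ^+ 2 * `|resid F (grid_point M W a c) (gaussian_vec p b) j| ^+ 2 :> R.
Proof.
move=> M0; have M0R : M%:R != 0 :> R by rewrite pnatr_eq0 -lt0n.
rewrite /resid_term natrD !sqdistE /resid /gaussian_vec /grid_point ComplexM ComplexB.
rewrite sqr_normC !natrD !natrM mulrDr -!exprMn.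
by congr (_ ^+ 2 + _ ^+ 2); field.
Qed.

(** The factor 16 leaves room for rounding lam to the grid; see
    Sp_ap_near_accepted. *)
Definition small_residual F M z p b n : Prop :=
  \sum_(j < n.+1) `|resid F z (gaussian_vec p b) j| ^+ 2 <
  16 / M%:R ^+ 2 * fine (sqnorm (gaussian_vec p b)).

Lemma witnessE F M W n a c p b : (0 < M)%N ->
  witness F M W n a c p b <-> small_residual F M (grid_point M W a c) p b n.
Proof.
move=> M0; rewrite /witness /small_residual sqnorm_gaussian_vec/=.
have M2 : 0 < M%:R ^+ 2 :> R by rewrite exprn_gt0// ltr0n.
rewrite -(ltr_nat R) natrM !natr_sum.
under eq_bigr do rewrite resid_termE//.
by rewrite -mulr_sumr [16 / _ * _]mulrAC ltr_pdivlMr// [_ * M%:R ^+ 2]mulrC.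
Qed.

Lemma small_residual_approx_eig F M z p b : (0 < M)%N -> (forall n, small_residual F M z p b n) ->
  approx_eig F z (16 / M%:R ^+ 2).
Proof.
move=> M0 H; have vl : l2 (gaussian_vec p b) by rewrite /l2/= sqnorm_gaussian_vec ltry.
have M2 : 0 < 16 / M%:R ^+ 2 :> R by rewrite divr_gt0// exprn_gt0// ltr0n.
exists (gaussian_vec p b); split => //.
  rewrite (l2E vl) lte_fin -(pmulr_rgt0 _ M2); apply: le_lt_trans (H 0%N).
  by rewrite sumr_ge0// => j _; rewrite sqr_ge0.
rewrite (l2E vl) -EFinM; apply/sqnorm_leP => n; apply: le_trans (ltW (H n)).
by rewrite big_ord_recr/= lerDl sqr_ge0.
Qed.

Lemma small_residual_intro F M z p b n :
  (sqnorm (resid F z (gaussian_vec p b)) < (16 / M%:R ^+ 2)%:E * sqnorm (gaussian_vec p b))%E ->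
  small_residual F M z p b n.
Proof.
rewrite sqnorm_gaussian_vec -EFinM /small_residual sqnorm_gaussian_vec/= -lte_fin; apply: le_lt_trans.
exact: partial_le_sqnorm.
Qed.

Lemma resid_bound F (c : R) lam x : 0 <= c -> koopman_bound F c -> l2 x ->
  (sqnorm (resid F lam x) <= (2 * c + 2 * `|lam| ^+ 2)%:E * sqnorm x)%E.
Proof.
move=> c0 Fc xl; have rl := l2_resid lam Fc xl.
have Fxl : l2 (x \o F) := l2_le (Fc x xl) xl.
have := @sqnorm_lin _ (resid F lam x) (x \o F) (fun j => lam * x j) 2 2.
rewrite sqnormZ; move: (Fc x xl).
rewrite (l2E xl) (l2E rl) (l2E Fxl) -!EFinM -EFinD !lee_fin => h1 /(_ _ _ _) h2.
apply: (@le_trans _ _ (2 * fine (sqnorm (x \o F)) + 2 * (`|lam| ^+ 2 * fine (sqnorm x)))).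
  apply: h2 => // j.
  by have := sqr_normC_add (x (F j)) (- (lam * x j)); rewrite normrN.
by move: h1; move: (fine _) (fine _) (`|lam| ^+ 2) => u w q; lra.
Qed.

Lemma residD F lam x y : resid F lam (fun j => x j + y j) =
  (fun j => resid F lam x j + resid F lam y j).
Proof. by apply/funext => j; rewrite /resid mulrDr opprD addrACA. Qed.

(** Cutting off a tail of small norm changes the residual little, as T is bounded. *)
Lemma approx_eig_finsupp F (c : R) lam (e : R) : 0 < c -> koopman_bound F c -> 0 < e ->
  approx_eig F lam e -> exists N (v : nat -> C), [/\ forall j, (N <= j)%N -> v j = 0,
    (0 < sqnorm v)%E & (sqnorm (resid F lam v) <= (16 * e)%:E * sqnorm v)%E].
Proof.
move=> c0 Fc e0 [v [vl v0 ve]].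
set K := 2 * c + 2 * `|lam| ^+ 2.
have K0 : 0 < K by rewrite /K ltr_pwDl ?mulr_gt0// mulr_ge0// sqr_ge0.
have s0 : 0 < fine (sqnorm v) by rewrite -lte_fin -(l2E vl).
set s := fine (sqnorm v) in s0.
(* The first bound preserves the norm of v up to a factor, the second keeps the
   residual of the tail below e s. *)
pose d := Num.min (s / 4) (e * s / K).
have d0 : 0 < d by rewrite lt_min !divr_gt0// mulr_gt0.
have [N Nd] := sqnorm_tail vl d0.
set tl := cutoff [set j | (N <= j)%N] v in Nd.
pose t : nat -> C := cutoff (~` [set j | (N <= j)%N]) v.
have tll : l2 tl := l2_cutoff _ vl.
have tt : l2 t := l2_cutoff _ vl.
have vE : v = (fun j => t j + tl j).
  apply/funext => j; rewrite /t /tl; have [Nj|nNj] := pselect ([set j | (N <= j)%N] j).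
    by rewrite cutoff_out ?add0r ?cutoff_in// => /(_ Nj).
  by rewrite cutoff_in// cutoff_out ?addr0.
have tE : t = (fun j => v j + -1 * tl j).
  by apply/funext => j; rewrite vE mulN1r addrK.
have dle1 : d <= s / 4 by rewrite ge_min lexx.
have dle2 : K * d <= e * s.
  by rewrite mulrC -ler_pdivlMr// ge_min lexx orbT.
exists N, t.
have tS : s <= 2 * fine (sqnorm t) + 2 * d.
  have := sqnormD t tl; rewrite -vE (l2E tt) (l2E tll) (l2E vl) -!EFinM -EFinD lee_fin.
  by move: Nd; rewrite (l2E tll) lee_fin -/s; lra.
split.
- by move=> j Nj; rewrite /t cutoff_out// => /(_ Nj).
- by rewrite (l2E tt) lte_fin; lra.
have rtl := resid_bound lam (ltW c0) Fc tll; rewrite -/K in rtl.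
have rl := l2_resid lam Fc vl; have rtll := l2_resid lam Fc tll.
have rt := l2_resid lam Fc tt.
have : (sqnorm (resid F lam t) <= 2%:E * sqnorm (resid F lam v) + 2%:E * sqnorm (resid F lam tl))%E.
  rewrite {1}tE residD residZ; apply: le_trans (sqnormD _ _) _.
  by rewrite sqnormZ normrN normC1 expr1n mul1e.
move: rtl ve Nd; rewrite (l2E rl) (l2E rtll) (l2E rt) (l2E tt) (l2E tll) (l2E vl) -/s.
rewrite -!EFinM -EFinD !lee_fin => h1 h2 h3 h4.
have h5 : K * fine (sqnorm tl) <= K * d by rewrite ler_pM2l.
have h6 : e * s <= e * (2 * fine (sqnorm t) + 2 * d) by rewrite ler_pM2l.
have h7 : e * d <= e * (s / 4) by rewrite ler_pM2l.
lra.
Qed.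

Definition posz_part (z : int) : nat := if 0 <= z then `|z|%N else 0%N.

Lemma posz_partB (z : int) :
  (posz_part z)%:R - (posz_part (- z))%:R = z%:~R :> R.
Proof.
rewrite /posz_part oppr_ge0; case: (ltgtP z 0) => [z0|z0|->].
- rewrite sub0r abszN (_ : `|z|%N%:R = (- z)%:~R :> R); last first.
    by rewrite -(ltz0_abs z0).
  by rewrite mulrNz opprK.
- by rewrite subr0 -[in RHS](gtz0_abs z0).
- by rewrite oppr0 addr0.
Qed.

(** The base is taken larger than all the digits. *)
Lemma gaussian_vec_surj (N : nat) (u w : nat -> int) :
  (forall j, (N <= j)%N -> u j = 0 /\ w j = 0) ->
  exists p b, forall j, gaussian_vec p b j = Complex (u j)%:~R (w j)%:~R.
Proof.
move=> uw0.
pose d i := nth 0%N [:: posz_part (u (i %/ 4)%N); posz_part (- u (i %/ 4)%N);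
  posz_part (w (i %/ 4)%N); posz_part (- w (i %/ 4)%N)] (i %% 4).
have d0 i : (4 * N <= i)%N -> d i = 0%N.
  move=> iN; have [|u0 w0] := uw0 (i %/ 4)%N; first by rewrite leq_divRL// mulnC.
  rewrite /d u0 w0 oppr0 (_ : posz_part 0 = 0%N)//.
  by case: (i %% 4)%N => [|[|[|[|?]]]] //=; rewrite nth_nil.
pose b := (\max_(i < 4 * N) d i)%N.
have db i : (d i < b.+2)%N.
  have [iN|/d0->//] := ltnP i (4 * N).
  rewrite ltnW// !ltnS.
  exact: (@leq_bigmax _ (fun i : 'I_(4 * N) => d i) (Ordinal iN)).
exists (\sum_(i < 4 * N) d i * b.+2 ^ i)%N, b => j.
have cE e : (e < 4)%N -> coord (\sum_(i < 4 * N) d i * b.+2 ^ i)%N b j e =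
   nth 0%N [:: posz_part (u j); posz_part (- u j); posz_part (w j); posz_part (- w j)] e.
  move=> e4; rewrite /coord digit_expansion//.
  have [dj dm] : ((4 * j + e) %/ 4 = j /\ (4 * j + e) %% 4 = e)%N by lia.
  by case: ifP => [_|/negbT]; [|rewrite -leqNgt => /d0]; rewrite /d dj dm.
by rewrite /gaussian_vec !cE//= !posz_partB.
Qed.

Lemma sqr_floor_le (x y : R) :
  `|Complex x y - Complex (Num.floor x)%:~R (Num.floor y)%:~R : C| ^+ 2 <= 2.
Proof.
rewrite ComplexB sqr_normC.
have := floor_itv x; have := floor_itv y; rewrite !intrD.
move: (Num.floor x)%:~R (Num.floor y)%:~R => a c /andP[h1 h2] /andP[h3 h4].
have H (t : R) : 0 <= t -> t <= 1 -> t ^+ 2 <= 1 by move=> *; rewrite expr_le1.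
have := H (x - a); have := H (y - c); lra.
Qed.

(** Scale a finitely supported approximate eigenvector by a large Q and round
    down. The error rho has N entries of squared modulus at most 2, whatever Q
    is, so it is negligible against Q^2 S(v). *)
Lemma Sp_ap_gaussian_vec F lam (e : R) : bounded_on_l2 (koopman (R := R) F) ->
  Sp_ap (koopman F) lam -> 0 < e ->
  exists p b, (0 < sqnorm (gaussian_vec p b))%E /\
    (sqnorm (resid F lam (gaussian_vec p b)) <= e%:E * sqnorm (gaussian_vec p b))%E.
Proof.
move=> Fb Sl e0; have /koopman_boundP[c c0 Fc] := Fb.
pose e' := e / 128; have e'0 : 0 < e' by rewrite divr_gt0.
have [N [v [vN v0 ve]]] :=
  approx_eig_finsupp c0 Fc e'0 ((Sp_apP lam Fb).1 Sl _ e'0).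
have vl : l2 v by rewrite /l2/= (sqnorm_finsupp vN) ltry.
have s0 : 0 < fine (sqnorm v) by rewrite -lte_fin -(l2E vl).
set s := fine (sqnorm v) in s0.
set K := 2 * c + 2 * `|lam| ^+ 2.
have K0 : 0 < K by rewrite /K ltr_pwDl ?mulr_gt0// mulr_ge0// sqr_ge0.
(* For Q^2 >= B the rounding errors are dominated both by Q^2 S(v) and by
   e Q^2 S(v). *)
pose B : R := (4 * K * N%:R + 2 * e * N%:R) / (e / 4 * s) + 4 * N%:R / s + 1.
have es0 : 0 < e / 4 * s by rewrite mulr_gt0// divr_gt0.
have B0 : 0 <= B.
  by rewrite /B !addr_ge0// divr_ge0 ?(ltW es0) ?(ltW s0)// ?addr_ge0// !mulr_ge0// ltW.
pose Q : R := (Num.bound B)%:R.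
have BQ : B < Q := archi_boundP B0.
have Q2 : B <= Q ^+ 2.
  have : 1 <= B.
    by rewrite /B lerDr addr_ge0// divr_ge0 ?(ltW es0) ?(ltW s0)// ?addr_ge0// !mulr_ge0// ltW.
  by move=> B1; rewrite expr2; nra.
pose u j : int := Num.floor (Q * complex.Re (v j)).
pose w j : int := Num.floor (Q * complex.Im (v j)).
have [j Nj|p [b pb]] := @gaussian_vec_surj N u w.
  by rewrite /u /w vN//= mulr0 floor0.
pose rho : nat -> C := fun j => gaussian_vec p b j + - (Complex Q 0 * v j).
have QvE j : Complex Q 0 * v j = Complex (Q * complex.Re (v j)) (Q * complex.Im (v j)) :> C.
  by case: (v j) => x y; rewrite ComplexM/= !mul0r subr0 addr0.
have rhoj j : `|rho j| ^+ 2 <= 2.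
  by rewrite /rho pb QvE -normrN opprB sqr_floor_le.
have rho0 j : (N <= j)%N -> rho j = 0.
  move=> Nj; rewrite /rho pb vN// mulr0 subr0 /u /w vN//= mulr0 floor0//.
have rhoS : fine (sqnorm rho) <= 2 * N%:R.
  rewrite (sqnorm_finsupp rho0)/= mulr_natr -[X in _ <= _ *+ X]card_ord -sumr_const.
  by apply: ler_sum => i _.
have rhol : l2 rho by rewrite /l2/= (sqnorm_finsupp rho0) ltry.
have wl : l2 (gaussian_vec p b) by rewrite /l2/= sqnorm_gaussian_vec ltry.
have Qv : (fun j => Complex Q 0 * v j) = (fun j => gaussian_vec p b j + -1 * rho j).
  by apply/funext => j; rewrite mulN1r /rho opprD opprK addrA subrr add0r.
have wE : gaussian_vec p b = (fun j => Complex Q 0 * v j + rho j).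
  by apply/funext => j; rewrite /rho addrC subrK.
have QN : `|Complex Q 0 : C| ^+ 2 = Q ^+ 2 by rewrite normC_real real_normK ?num_real.
have h1 : Q ^+ 2 * s <= 2 * fine (sqnorm (gaussian_vec p b)) + 2 * fine (sqnorm rho).
  have := sqnormD (gaussian_vec p b) (fun j => -1 * rho j).
  rewrite -Qv !sqnormZ QN normrN normC1 expr1n mul1e.
  by rewrite (l2E vl) (l2E wl) (l2E rhol) -!EFinM -EFinD lee_fin.
have rl := l2_resid lam Fc vl; have rwl := l2_resid lam Fc wl.
have rrl := l2_resid lam Fc rhol.
have h2 : fine (sqnorm (resid F lam (gaussian_vec p b))) <=
    2 * (Q ^+ 2 * (16 * e' * s)) + 2 * (K * fine (sqnorm rho)).
  have := sqnormD (resid F lam (fun j => Complex Q 0 * v j)) (resid F lam rho).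
  rewrite -residD -wE residZ sqnormZ QN.
  have := resid_bound lam (ltW c0) Fc rhol; rewrite -/K; move: ve.
  rewrite (l2E vl) (l2E rwl) (l2E rl) (l2E rrl) (l2E rhol) -!EFinM -EFinD !lee_fin -/s.
  move=> k1 k2 k3; apply: le_trans k3 _.
  by rewrite lerD ?ler_wpM2l// ?sqr_ge0.
have h3 : K * fine (sqnorm rho) <= K * (2 * N%:R) by rewrite ler_pM2l.
have h4 : 4 * N%:R < Q ^+ 2 * s.
  rewrite -ltr_pdivrMr//; apply: lt_le_trans Q2.
  rewrite /B; have : 0 <= (4 * K * N%:R + 2 * e * N%:R) / (e / 4 * s).
    by rewrite divr_ge0 ?(ltW es0)// ?addr_ge0// !mulr_ge0// ltW.
  lra.
have h5 : 4 * K * N%:R + 2 * e * N%:R <= Q ^+ 2 * (e / 4 * s).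
  rewrite -ler_pdivrMr//; apply: le_trans Q2.
  rewrite /B; have : 0 <= 4 * N%:R / s by rewrite divr_ge0 ?mulr_ge0// ltW.
  lra.
exists p, b; split; first by rewrite (l2E wl) lte_fin; lra.
rewrite (l2E wl) (l2E rwl) -EFinM lee_fin; apply: le_trans h2 _.
have h6 : e * (Q ^+ 2 * s) <= e * (2 * fine (sqnorm (gaussian_vec p b)) + 2 * (2 * N%:R)).
  by rewrite ler_pM2l// (le_trans h1)// lerD2l ler_wpM2l.
have h7 : Q ^+ 2 * (16 * e' * s) = Q ^+ 2 * s * e / 8 by rewrite /e'; field.
move: h3 h5 h6; rewrite h7.
move: (Q ^+ 2) (fine (sqnorm (gaussian_vec _ _))) (fine (sqnorm rho)) (N%:R : R) => q sw sr n.
lra.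
Qed.

End Semantics.

(** * Output strings as finite subsets of the plane *)

Section Grid.
Variable R : realType.
Local Notation C := (Rcomplex R).
Implicit Types (F : nat -> nat) (z lam : C).

Local Notation pts n := (points R (CodeSeq.decode n)).

Lemma block_codeE W M a c acc : block_code W M a c acc =
  CodeSeq.code [:: a, W, c, W, M.-1 & CodeSeq.decode acc].
Proof. by rewrite /block_code /cons_code !addnn /= CodeSeq.decodeK. Qed.

Lemma points_block W M a c acc : (0 < M)%N ->
  pts (block_code W M a c acc) = grid_point R M W a c :: pts acc.
Proof.
by move=> M0; rewrite block_codeE CodeSeq.codeK /= /grid_point prednK.
Qed.

Lemma block_code_gt0 W M a c acc : (0 < block_code W M a c acc)%N.
Proof. by rewrite /block_code /cons_code muln_gt0 expn_gt0. Qed.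

(** The output for the indices W and n, unless it is empty; its limits as n and
    then W grow are [accepted_within] and [accepted]. *)
Definition accepted_upto F M W n : set C := [set z | exists a c,
  [/\ (a <= W + W)%N, (c <= W + W)%N, z = grid_point R M W a c &
   exists p b, [/\ (p <= W)%N, (b <= W)%N & small_residual F M z p b n]]].

Lemma acceptsE F M W n a c : (0 < M)%N ->
  accepts F M W n a c <-> exists p b, [/\ (p <= W)%N, (b <= W)%N &
    small_residual F M (grid_point R M W a c) p b n].
Proof.
move=> M0; rewrite /accepts /witness_count lt0n sum_nat_eq0 negb_forall; split.
  move=> /existsP[p]/=; rewrite sum_nat_eq0 negb_forall => /existsP[b]/=.
  rewrite eqb0 negbK => /(@witnessE R F M W n a c p b M0) w; exists p, b; split => //.
    by rewrite -ltnS.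
  by rewrite -ltnS.
move=> [p [b [pW bW w]]]; apply/existsP; exists (Ordinal (pW : (p < W.+1)%N)) => /=.
rewrite sum_nat_eq0 negb_forall; apply/existsP; exists (Ordinal (bW : (b < W.+1)%N)) => /=.
by rewrite eqb0 negbK; exact/(@witnessE R F M W n a c p b M0).
Qed.

Lemma grid_code_points F M W n : (0 < M)%N ->
  [set` pts (grid_code F M W n)] = accepted_upto F M W n /\
  ((0 < grid_code F M W n)%N <-> accepted_upto F M W n !=set0).
Proof.
move=> M0; set L := (W + W).+1.
pose E m : set C := [set z | exists t, [/\ (t < m)%N, accepts F M W n (t %/ L) (t %% L) &
   z = grid_point R M W (t %/ L) (t %% L)]].
have EE : E (L * L)%N = accepted_upto F M W n.
  apply/seteqP; split => z.
    move=> [t [tL /(@acceptsE F M W n _ _ M0) acc ->]]; exists (t %/ L)%N, (t %% L)%N; split => //.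
    - by rewrite -ltnS -/L ltn_divLR.
    - by rewrite -ltnS -/L ltn_mod.
  move=> [a [c [aW cW zE acc]]]; rewrite zE in acc *.
  have cL : (c < L)%N by rewrite /L ltnS.
  have aL : (a < L)%N by rewrite /L ltnS.
  have [dE mE] : ((a * L + c) %/ L = a /\ (a * L + c) %% L = c)%N.
    by rewrite divnMDl ?modnMDl ?divn_small ?modn_small ?addn0.
  exists (a * L + c)%N; rewrite dE mE; split => //; last exact/(@acceptsE F M W n a c M0).
  have : (a.+1 * L <= L * L)%N by rewrite leq_mul2r aL orbT.
  by rewrite mulSn; lia.
rewrite -EE /grid_code -/L.
elim: (L * L)%N => [|m [IH1 IH2]].
  split=> /=; first by apply/seteqP; split => z //= -[t []].
  by split=> // -[z [t []]].
rewrite /=; case: ifP => acc.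
  split; last first.
    split => _; last by rewrite block_code_gt0.
    by exists (grid_point R M W (m %/ L) (m %% L)); exists m.
  rewrite points_block//; apply/seteqP; split => z /=.
    rewrite inE => /predU1P[->|]; first by exists m.
    have := IH1; move=> /seteqP[+ _] => /(_ z)/= h /h[t [tm ta ->]].
    by exists t; split => //; rewrite ltnW.
  move=> [t [tm ta ->]]; rewrite inE; move: tm; rewrite ltnS leq_eqVlt.
  move=> /predU1P[->|tm]; first by rewrite eqxx.
  apply/orP; right; have /seteqP[_] := IH1; apply.
  by exists t.
have Em : E m.+1 = E m.
  apply/seteqP; split => z [t [tm ta ->]]; exists t; split => //; last by rewrite ltnW.
  move: tm; rewrite ltnS leq_eqVlt => /predU1P[tm|//].
  by move: ta; rewrite tm acc.
by rewrite Em.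
Qed.

Definition or_zero (E : set C) : set C := [set z | E z \/ (E = set0 /\ z = 0)].

Lemma output_points F M W n : (0 < M)%N ->
  [set` pts (output_code F M W n)] = or_zero (accepted_upto F M W n).
Proof.
move=> M0; have [gE g0] := grid_code_points F W n M0.
rewrite /output_code; case: ifP => gc.
  rewrite gE; apply/seteqP; split => z; first by left.
  by move=> [//|[E0 _]]; move: gc => /g0; rewrite E0 => -[].
have E0 : accepted_upto F M W n = set0.
  by apply/eqP/negPn/negP => /set0P/g0; rewrite gc.
rewrite points_block// E0; apply/seteqP; split => z /=.
  rewrite /grid_point subrr mul0r inE => /eqP ->; right; split=> //.
by move=> [//|[_ ->]]; rewrite /grid_point subrr mul0r inE eqxx.
Qed.

End Grid.

(** * The first two limits are eventually constant *)

Section Limits.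
Variable R : realType.
Local Notation C := (Rcomplex R).
Implicit Types (F : nat -> nat) (z lam : C).

Definition accepted_within F M W : set C := [set z | exists a c,
  [/\ (a <= W + W)%N, (c <= W + W)%N, z = grid_point R M W a c &
   exists p b, [/\ (p <= W)%N, (b <= W)%N & forall n, small_residual F M z p b n]]].

Definition accepted F M : set C := [set z | exists W, accepted_within F M W z].

Lemma small_residual_anti F M z p b m n : (m <= n)%N ->
  small_residual F M z p b n -> small_residual F M z p b m.
Proof.
move=> mn; apply: le_lt_trans; rewrite -(subnKC mn) -addSn big_split_ord/= lerDl.
by rewrite sumr_ge0// => i _; exact: sqr_ge0.
Qed.

(** The test can only fail as n grows, and finitely many candidates are
    tested. *)
Lemma accepted_upto_stable F M W : exists N, forall n, (N <= n)%N ->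
  accepted_upto F M W n = accepted_within F M W.
Proof.
pose K := (W + W).+1.
pose P (q : 'I_K * 'I_K * 'I_K * 'I_K) n :=
  small_residual F M (grid_point R M W q.1.1.1 q.1.1.2) q.1.2 q.2 n.
have /choice[f fP] : forall q, exists N, P q N -> forall n, P q n.
  move=> q; have [H|/existsNP[n nP]] := pselect (forall n, P q n); first by exists 0%N.
  by exists n.
exists (\max_q f q)%N => n fn; apply/seteqP; split => z; last first.
  move=> [a [c [aW cW zE [p [b [pW bW w]]]]]]; exists a, c; split => //.
  by exists p, b.
move=> [a [c [aW cW zE [p [b [pW bW w]]]]]]; exists a, c; split => //.
exists p, b; split => // n'.
have pK : (p < K)%N by rewrite ltnS (leq_trans pW)// leq_addr.
have bK : (b < K)%N by rewrite ltnS (leq_trans bW)// leq_addr.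
rewrite zE in w *.
apply: (fP (Ordinal (aW : (a < K)%N), Ordinal (cW : (c < K)%N), Ordinal pK, Ordinal bK)).
by apply: small_residual_anti w; apply: leq_trans fn; exact: leq_bigmax.
Qed.

(** The position of a grid point relative to the centre is what matters: both
    indices are shifted by W' - W. *)
Lemma accepted_within_mono F M W W' : (W <= W')%N ->
  accepted_within F M W `<=` accepted_within F M W'.
Proof.
move=> WW z [a [c [aW cW -> [p [b [pW bW w]]]]]].
exists (a + (W' - W))%N, (c + (W' - W))%N; split.
- by lia.
- by lia.
- rewrite /grid_point !natrD natrB//.
  by congr (Complex (_ / _) (_ / _)); ring.
- by exists p, b; split => //; exact: leq_trans WW.
Qed.

Lemma accepted_approx_eig F M z : (0 < M)%N -> accepted F M z -> approx_eig F z (16 / M%:R ^+ 2).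
Proof.
by move=> M0 [W [a [c [_ _ _ [p [b [_ _ w]]]]]]]; exact: small_residual_approx_eig w.
Qed.

(** Accepted points are approximate eigenvalues, hence bounded in modulus, so
    finitely many grid points are concerned; W has to exceed their indices and
    their witnesses. *)
Lemma accepted_within_stable F M : bounded_on_l2 (koopman (R := R) F) -> (0 < M)%N ->
  exists N, forall W, (N <= W)%N -> accepted_within F M W = accepted F M.
Proof.
move=> /koopman_boundP[c c0 Fc] M0.
have M0R : 0 < M%:R :> R by rewrite ltr0n.
pose B := 2 * c + 2 * (16 / M%:R ^+ 2).
have e0 : 0 <= 16 / M%:R ^+ 2 :> R by rewrite divr_ge0// sqr_ge0.
have B0 : 0 <= B by rewrite /B addr_ge0// mulr_ge0// ltW.
have EB z : accepted F M z -> `|z| ^+ 2 <= B.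
  by move=> /(accepted_approx_eig M0); exact: approx_eig_bounded.
(* The integer coordinates of accepted points are less than T in modulus, so
   all of these points have indices in the window of half-width T. *)
pose T := Num.bound (M%:R * Num.sqrt B).
have MB0 : 0 <= M%:R * Num.sqrt B by rewrite mulr_ge0// ?sqrtr_ge0// ltW.
pose K := (T + T).+1.
have /choice[f fP] : forall q : 'I_K * 'I_K, exists W,
    accepted F M (grid_point R M T q.1 q.2) -> accepted_within F M W (grid_point R M T q.1 q.2).
  move=> q; have [[W EW]|nE] := pselect (accepted F M (grid_point R M T q.1 q.2)).
    by exists W.
  by exists 0%N.
exists (\max_q f q)%N => W fW; apply/seteqP; split => z; first by exists W.
move=> Ez; have [W' [a [d [aW dW zE _]]]] := Ez.
have coord_bound (x : nat) : `|(x%:R - W'%:R) / M%:R| <= `|z| ->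
    exists2 x' : nat, (x' < K)%N & x'%:R - T%:R = x%:R - W'%:R :> R.
  move=> xz.
  have xT : `|x%:R - W'%:R| < T%:R :> R.
    apply: le_lt_trans (archi_boundP MB0).
    have zB : `|z| <= Num.sqrt B.
      by rewrite -ler_sqr ?nnegrE ?sqrtr_ge0// sqr_sqrtr// EB.
    rewrite mulrC -ler_pdivrMr//; apply: le_trans zB; apply: le_trans xz.
    by rewrite normrM normfV (gtr0_norm M0R).
  move: xT; rewrite ltr_norml => /andP[x1 x2].
  have h1 : (W' < x + T)%N by rewrite -(ltr_nat R) natrD; lra.
  have h2 : (x < W' + T)%N by rewrite -(ltr_nat R) natrD; lra.
  exists (x + T - W')%N; first by rewrite /K; lia.
  by rewrite natrB ?natrD; [ring|exact: ltnW].
have [a' aK aE] : exists2 x' : nat, (x' < K)%N & x'%:R - T%:R = a%:R - W'%:R :> R.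
  by apply: coord_bound; rewrite zE; exact: normC_Re.
have [d' dK dE] : exists2 x' : nat, (x' < K)%N & x'%:R - T%:R = d%:R - W'%:R :> R.
  by apply: coord_bound; rewrite zE; exact: normC_Im.
have zE' : z = grid_point R M T (Ordinal aK) (Ordinal dK).
  by rewrite zE /grid_point/= aE dE.
apply: (@accepted_within_mono F M (f (Ordinal aK, Ordinal dK))).
  by apply: leq_trans fW; exact: leq_bigmax.
by rewrite zE'; apply: fP; rewrite /= -zE'.
Qed.

Lemma accepted_upto_finite F M W n : (0 < M)%N -> finite_set (accepted_upto F M W n : set C).
Proof. by move=> M0; rewrite -(grid_code_points R F W n M0).1; exact: finite_seq. Qed.

Lemma accepted_within_finite F M W : (0 < M)%N -> finite_set (accepted_within F M W).
Proof.
move=> M0; have [N /(_ N (leqnn N)) <-] := accepted_upto_stable F M W.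
exact: accepted_upto_finite.
Qed.

Lemma accepted_finite F M : bounded_on_l2 (koopman (R := R) F) -> (0 < M)%N ->
  finite_set (accepted F M).
Proof.
move=> Fb M0; have [N /(_ N (leqnn N)) <-] := accepted_within_stable Fb M0.
exact: accepted_within_finite.
Qed.

(** Round lam down to the grid point z, so that |lam - z|^2 <= 2/M^2. An integer
    vector whose squared relative residual at lam is 1/M^2 has one of at most
    2/M^2 + 4/M^2 at z, which is less than 16/M^2. *)
Lemma Sp_ap_near_accepted F M lam : bounded_on_l2 (koopman (R := R) F) -> (0 < M)%N ->
  Sp_ap (koopman F) lam -> exists2 z, accepted F M z & `|lam - z| ^+ 2 <= 2 / M%:R ^+ 2.
Proof.
move=> Fb M0 Sl; have M0R : 0 < M%:R :> R by rewrite ltr0n.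
have M2 : 0 < M%:R ^+ 2 :> R by rewrite exprn_gt0.
pose u := Num.floor (M%:R * complex.Re lam).
pose w := Num.floor (M%:R * complex.Im lam).
pose z : C := Complex (u%:~R / M%:R) (w%:~R / M%:R).
have lz : `|lam - z| ^+ 2 <= 2 / M%:R ^+ 2.
  rewrite ler_pdivlMr// mulrC.
  have -> : M%:R ^+ 2 = `|Complex M%:R 0 : C| ^+ 2.
    by rewrite normC_real real_normK ?num_real.
  rewrite -exprMn -normCM mulrBr.
  have -> : Complex M%:R 0 * lam = Complex (M%:R * complex.Re lam) (M%:R * complex.Im lam) :> C.
    by case: (lam) => x y; rewrite ComplexM/= !mul0r subr0 addr0.
  rewrite [X in _ - X](_ : _ = Complex u%:~R w%:~R); first exact: sqr_floor_le.
  rewrite /z ComplexM !mul0r subr0 addr0.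
  by congr (Complex _ _); rewrite mulrC divfK// gt_eqF.
have e0 : 0 < 1 / M%:R ^+ 2 :> R by rewrite divr_gt0.
have [p [b [v0 ve]]] := Sp_ap_gaussian_vec Fb Sl e0.
pose W := maxn (maxn p b) (maxn `|u| `|w|).
exists z => //; exists W.
have coordE (t : int) : (`|t| <= W)%N -> exists2 a : nat, (a <= W + W)%N &
    a%:R - W%:R = t%:~R :> R.
  move=> tW; have tW0 : 0 <= t + W%:Z by lia.
  exists (absz (t + W%:Z)%R); first by lia.
  have -> : (absz (t + W%:Z)%R)%:R = (t + W%:Z)%:~R :> R by rewrite -[in RHS](gez0_abs tW0).
  by rewrite intrD addrK.
have [a aW aE] := coordE u (leq_trans (leq_maxl _ _) (leq_maxr _ _)).
have [c cW cE] := coordE w (leq_trans (leq_maxr _ _) (leq_maxr _ _)).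
exists a, c; split => //; first by rewrite /grid_point aE cE.
exists p, b; split.
- exact: leq_trans (leq_maxl _ _) (leq_maxl _ _).
- exact: leq_trans (leq_maxr _ _) (leq_maxl _ _).
move=> n; apply: small_residual_intro.
have vl : l2 (gaussian_vec R p b) by rewrite /l2/= sqnorm_gaussian_vec ltry.
have -> : resid F z (gaussian_vec R p b) =
    (fun j => resid F lam (gaussian_vec R p b) j + (lam - z) * gaussian_vec R p b j).
  by apply/funext => j; rewrite /resid mulrBl addrA subrK.
apply: le_lt_trans (sqnormD _ _) _; rewrite sqnormZ.
have rl : l2 (resid F lam (gaussian_vec R p b)) := l2_le ve vl.
move: v0 ve; rewrite (l2E vl) (l2E rl) -!EFinM -EFinD lee_fin !lte_fin => v0 ve.
set s := fine (sqnorm (gaussian_vec R p b)) in v0 ve *.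
have := ler_wpM2r (ltW v0) lz.
have : 0 < 1 / M%:R ^+ 2 * s by rewrite mulr_gt0.
move: ve; rewrite (mulrAC 1) (mulrAC 2) (mulrAC 16).
rewrite -!mulrA; move: (s * _) => q; lra.
Qed.

End Limits.

(** * The tower of height three *)

Section Tower.
Variable R : realType.
Local Notation C := (Rcomplex R).
Implicit Types (A : OmegaN R) (z lam : C).

Definition Sp_ap_compacts A : compacts R :=
  Compacts (Sp_ap_compact (svalP A)) (Sp_ap_nonempty (svalP A)).

Lemma finite_compacts_ex (E : set C) : exists K : compacts R,
  finite_set E -> E !=set0 -> cset K = E.
Proof.
have [[Ef E0]|nE] := pselect (finite_set E /\ E !=set0).
  by exists (Compacts (finite_compact Ef) E0).
have c0 : compact [set (0 : C)] by exact: compact_set1.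
by exists (Compacts c0 (ex_intro _ 0 erefl)) => Ef E0; case: nE.
Qed.

Definition to_compacts (E : set C) : compacts R := projT1 (cid (finite_compacts_ex E)).

Lemma to_compactsE E : finite_set E -> E !=set0 -> cset (to_compacts E) = E.
Proof. exact: (projT2 (cid (finite_compacts_ex E))). Qed.

Lemma or_zero_finite (E : set C) : finite_set E -> finite_set (or_zero E).
Proof.
move=> Ef; apply: (@sub_finite_set _ _ (E `|` [set 0])).
  by move=> z [Ez|[_ ->]]; [left|right].
by rewrite finite_setU; split => //; exact: finite_set1.
Qed.

Lemma or_zero_nonempty (E : set C) : or_zero E !=set0.
Proof.
have [->|/set0P[z Ez]] := eqVneq E set0; first by exists 0; right.
by exists z; left.
Qed.

Lemma or_zero_id (E : set C) : E !=set0 -> or_zero E = E.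
Proof.
move=> [z Ez]; apply/seteqP; split => [y [//|[E0 _]]|y]; last by left.
by move: Ez; rewrite E0.
Qed.

(** Fine enough for rounding to cost at most 2^-(m+1); see mesh_sq. *)
Definition mesh m := (2 ^ m.+2)%N.

Lemma mesh_gt0 m : (0 < mesh m)%N. Proof. by rewrite expn_gt0. Qed.

Definition tower (s : seq nat) A : compacts R :=
  match s with
  | [:: m] => to_compacts (accepted (sval A) (mesh m))
  | [:: m; W] => to_compacts (or_zero (accepted_within (sval A) (mesh m) W))
  | [:: m; W; n] => to_compacts (or_zero (accepted_upto (sval A) (mesh m) W n))
  | _ => Sp_ap_compacts A
  end.

Lemma tower1E m A : cset (tower [:: m] A) = accepted (sval A) (mesh m).
Proof.
apply: to_compactsE; first exact: accepted_finite (svalP A) (mesh_gt0 m).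
have [lam Sl] := Sp_ap_nonempty (svalP A).
by have [z Ez _] := Sp_ap_near_accepted (svalP A) (mesh_gt0 m) Sl; exists z.
Qed.

Lemma tower2E m W A : cset (tower [:: m; W] A) = or_zero (accepted_within (sval A) (mesh m) W).
Proof.
apply: to_compactsE; last exact: or_zero_nonempty.
by apply: or_zero_finite; exact: accepted_within_finite (mesh_gt0 m).
Qed.

Lemma tower3E m W n A :
  cset (tower [:: m; W; n] A) = or_zero (accepted_upto (sval A) (mesh m) W n).
Proof.
apply: to_compactsE; last exact: or_zero_nonempty.
by apply: or_zero_finite; exact: accepted_upto_finite (mesh_gt0 m).
Qed.

Lemma tower_cvg3 m W A : tower [:: m; W; n] A @[n --> \oo] --> tower [:: m; W] A.
Proof.
apply: cvg_near_cst; have [N NP] := accepted_upto_stable R (sval A) (mesh m) W.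
exists N => // n /= Nn; apply: compacts_inj.
by rewrite tower2E tower3E NP.
Qed.

Lemma tower_cvg2 m A : tower [:: m; W] A @[W --> \oo] --> tower [:: m] A.
Proof.
apply: cvg_near_cst; have [N NP] := accepted_within_stable (svalP A) (mesh_gt0 m).
exists N => // W /= NW; apply: compacts_inj.
rewrite tower2E NP// tower1E; apply: or_zero_id; rewrite -tower1E.
exact: cset_nonempty.
Qed.

Lemma mdistE (A B : compacts R) : mdist A B = Num.max (excess A B) (excess B A).
Proof. by []. Qed.

Lemma mesh_inv2 m : 16 / (mesh m)%:R ^+ 2 = (4^-1 : R) ^+ m.
Proof.
have t0 : (4 : R) ^+ m != 0 by rewrite expf_neq0// pnatr_eq0.
have -> : (mesh m)%:R ^+ 2 = 16 * 4 ^+ m :> R.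
  rewrite /mesh natrX -exprM mulnC exprM (_ : (2 : R) ^+ 2 = 4); last by lra.
  by rewrite !exprS mulrA; congr (_ * _); lra.
by rewrite exprVn; field.
Qed.

Lemma mesh_sq m : 2 / (mesh m)%:R ^+ 2 <= (2 ^- m.+1) ^+ 2 :> R.
Proof.
have -> : 2 / (mesh m)%:R ^+ 2 = (4^-1 : R) ^+ m / 8 by rewrite -mesh_inv2; lra.
have -> : (2 ^- m.+1) ^+ 2 = (4^-1 : R) ^+ m / 4.
  rewrite -exprVn -exprM mulnC exprM exprS mulrC; congr (_ ^+ _ * _).
    by rewrite expr2 -invfM; congr (_^-1); lra.
  by rewrite expr2 -invfM; congr (_^-1); lra.
have : 0 <= (4^-1 : R) ^+ m by rewrite exprn_ge0//; lra.
lra.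
Qed.

Lemma Sp_ap_near_tower m A lam : Sp_ap (koopman (sval A)) lam ->
  dist_to lam (tower [:: m] A) <= 2 ^- m.+1.
Proof.
move=> Sl; have [z Ez lz] := Sp_ap_near_accepted (svalP A) (mesh_gt0 m) Sl.
have : cset (tower [:: m] A) z by rewrite tower1E.
move=> /(dist_to_le lam)/le_trans; apply.
rewrite -ler_sqr ?nnegrE ?invr_ge0 ?exprn_ge0//.
exact: le_trans lz (mesh_sq m).
Qed.

(** The points of a disc at distance at least e from the spectrum form a compact
    set, on which being an approximate eigenvalue fails for a common error
    eta; accepted points have the error 16/M^2, which is eventually less. *)
Lemma tower_near_Sp_ap A (e : R) : 0 < e -> exists N, forall m, (N <= m)%N ->
  forall z, cset (tower [:: m] A) z -> dist_to z (Sp_ap_compacts A) <= e.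
Proof.
move=> e0; have /koopman_boundP[c c0 Fc] := svalP A.
pose B := Num.sqrt (2 * c + 2 * 16).
have B0 : 0 <= 2 * c + 2 * 16 by rewrite addr_ge0// mulr_ge0// ltW.
pose K : set C := [set z | `|z| <= B] `&` [set z | e <= dist_to z (Sp_ap_compacts A)].
have Kc : compact K.
  apply: (@compactC _ _ B) => [|z []//].
  by apply: closedI; [exact: closed_disc|exact: closed_far].
have [z [_ /= ez]|eta eta0 Keta] := compact_not_approx_eig (F := sval A) Kc.
  apply: contrapT => H; move: ez; rewrite leNgt => /negP; apply.
  apply: le_lt_trans e0.
  have Sz : cset (Sp_ap_compacts A) z.
    apply/(Sp_apP z (svalP A)) => d d0; apply: contrapT => nd; apply: H.
    by exists d.
  by rewrite (le_trans (dist_to_le z Sz))// subrr normr0.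
have [N _ NP] : exists2 N, (0 < N)%N & (4^-1 : R) ^+ N < Num.min eta 1.
  apply: exists_expr_lt; last by rewrite lt_min eta0 ltr01.
  by apply/andP; split; lra.
exists N => m Nm z; rewrite tower1E => Ez; rewrite leNgt; apply/negP => ez.
have small : 16 / (mesh m)%:R ^+ 2 <= Num.min eta 1 :> R.
  apply: le_trans (ltW NP).
  rewrite mesh_inv2.
  by apply: ler_wiXn2l => //; lra.
have ap := accepted_approx_eig (mesh_gt0 m) Ez.
apply: (Keta z); last first.
  by apply: approx_eig_le ap; rewrite (le_trans small)// ge_min lexx.
split; last exact: ltW.
rewrite /= -ler_sqr ?nnegrE ?sqrtr_ge0// sqr_sqrtr//.
apply: approx_eig_bounded Fc _ => //.
by apply: approx_eig_le ap; rewrite (le_trans small)// ge_min; apply/orP; right; lra.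
Qed.

Lemma tower_cvg1 A : tower [:: m] A @[m --> \oo] --> Sp_ap_compacts A.
Proof.
apply/cvg_ballP => e e0.
have e20 : 0 < e / 2 by rewrite divr_gt0.
have [N NP] := tower_near_Sp_ap A e20.
have h01 : 0 <= (2^-1 : R) < 1 by apply/andP; split; lra.
have [M _ MP] := exists_expr_lt 0 h01 e20.
exists (maxn N M) => // m /= NMm; rewrite ballEmdist/= mdistE gt_max.
apply/andP; split; apply: (@le_lt_trans _ _ (e / 2)); try (by rewrite ltr_pdivrMr ?ltr_pMr ?ltr1n).
  apply: excess_le => lam Sl; apply: le_trans (Sp_ap_near_tower m Sl) _.
  apply: le_trans (ltW MP); rewrite -exprVn; apply: ler_wiXn2l.
  - by case/andP: h01.
  - by case/andP: h01 => _ /ltW.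
  - by rewrite (leq_trans (leq_maxr N M))// (leq_trans NMm).
by apply: excess_le => z; apply: NP; rewrite (leq_trans (leq_maxl N M)).
Qed.

Lemma tower_general_algorithm s : size s = 3 ->
  general_algorithm (problemN Sp_ap_compacts) (tower s).
Proof.
case: s => [|m [|W [|n [|]]]] // _.
exists (fun _ => (fun j => @evalN R j) @` [set j | (j < n.+1)%N]) => A; split.
- by move=> _ [j _ <-]; exists j.
- by exists (@evalN R 0), 0%N.
- by apply: finite_image; exact: finite_II.
move=> B AB; split => //.
have FAB j : (j < n.+1)%N -> sval B j = sval A j.
  by move=> jn; symmetry; apply: (AB (@evalN R j)); exists j.
apply: compacts_inj; rewrite !tower3E; congr or_zero.
have witE z p b : small_residual (sval B) (mesh m) z p b n = small_residual (sval A) (mesh m) z p b n.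
  rewrite /small_residual; congr (is_true (_ < _)); apply: eq_bigr => j _.
  by rewrite /resid FAB.
rewrite /accepted_upto; apply/seteqP; split => z [a [c [? ? ? [p [b [? ?]]]]]].
  by rewrite witE => ?; exists a, c; split => //; exists p, b.
by rewrite -witE => ?; exists a, c; split => //; exists p, b.
Qed.

Lemma tower_general : general_tower (problemN Sp_ap_compacts) 3 tower.
Proof.
split => //; last exact: tower_general_algorithm.
case=> [|m [|W [|]]] //= A _.
- exact: tower_cvg1.
- exact: tower_cvg2.
- exact: tower_cvg3.
Qed.

Lemma tower_arithmetic : arithmetic_tower (problemN Sp_ap_compacts) (@evalN R) 3 tower.
Proof.
split; [by []|exact: tower_general|].
have [p pP] := output_program; exists p => A.
case=> [|m [|W [|n [|]]]] // _; exists (output_code (sval A) (mesh m) W n).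
  exact: pP.
by rewrite tower3E output_points// mesh_gt0.
Qed.

(** Adding the spectrum to the output makes the inclusion trivial, and the
    distance is controlled because the spectrum is close to the output. *)
Definition enclosure m A : compacts R :=
  Compacts (compactU (@cset_compact _ (tower [:: m] A)) (@cset_compact _ (Sp_ap_compacts A)))
    (let: ex_intro z Sz := Sp_ap_nonempty (svalP A) in ex_intro _ z (or_intror Sz)).

Lemma enclosure_dist m A : mdist (enclosure m A) (tower [:: m] A) <= 2 ^- m.+1.
Proof.
have p0 : 0 <= (2 : R) ^- m.+1 by rewrite invr_ge0 exprn_ge0.
rewrite mdistE ge_max; apply/andP; split; apply: excess_le => z.
  move=> [Ez|Sz]; last exact: Sp_ap_near_tower.
  by rewrite (le_trans (dist_to_le z Ez))// subrr normr0.
move=> Ez; have Ez' : cset (enclosure m A) z by left.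
by rewrite (le_trans (dist_to_le z Ez'))// subrr normr0.
Qed.

End Tower.

Theorem theorem2p15 (R : realType) :
  exists Xi_ap : OmegaN R -> compacts R,
    (forall F : OmegaN R, cset (Xi_ap F) = Sp_ap (koopman (sval F))) /\
    ~ Delta3G (problemN Xi_ap) /\
    Pi3A (problemN Xi_ap) (@evalN R).
Proof.
exists (@Sp_ap_compacts R); split=> //; split; first exact: not_Delta3G.
exists (@tower R), (@enclosure R); split; first exact: tower_arithmetic.
move=> A; split.
- by move=> n z Sz; right.
- exact: tower_cvg1.
- by move=> n; exact: enclosure_dist.
Qed.
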